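(* For every integer $n \geq 3$, the graph $G(2n+1, 2n, 2n)$ has a nonorientable quadrangular embedding.
   Context: For nonnegative integers $m,n,k$ with $k \le \min(m,n)$, $G(m,n,k)$ denotes the nearly complete bipartite graph obtained from the complete bipartite graph $K_{m,n}$ (with $m$ white vertices and $n$ black vertices) by deleting $k$ pairwise independent edges (a matching of size $k$). An embedding of a graph in a closed surface is cellular if every face (component of the complement) is an open disk; a quadrangular embedding is a cellular embedding in which every face is bounded by a closed walk of length 4. A nonorientable quadrangular embedding is a quadrangular embedding in a nonorientable closed surface. *)

(* Defs.v *)
From HB Require Import structures.
From mathcomp Require Import all_boot all_order all_algebra.
From mathcomp Require Import all_classical all_reals all_analysis.
Import Order.TTheory GRing.Theory Num.Theory.
Import numFieldNormedType.Exports.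

Set Implicit Arguments.
Unset Strict Implicit.
Unset Printing Implicit Defensive.

Local Open Scope classical_set_scope.
Local Open Scope ring_scope.

Record simple_graph := SimpleGraph {
  vertex : finType;
  adj : rel vertex;
  adj_sym : symmetric adj;
  adj_irr : irreflexive adj }.

(* White vertices are [inl i], black vertices are [inr j]. The deleted matching
   consists of the edges {inl i, inr i} with i < k; all matchings of size k in
   K_{m,n} are equivalent under automorphisms preserving the colour classes.
   The intended range is k <= minn m n. *)
Definition ncb_adj (m n k : nat) : rel ('I_m + 'I_n) := fun u v =>
  match u, v with
  | inl i, inr j | inr j, inl i => ~~ ((i == j :> nat) && (i < k)%N)
  | _, _ => false
  end.

Lemma ncb_adj_sym m n k : symmetric (@ncb_adj m n k).
Proof. by case=> [i|j] [i'|j']. Qed.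

Lemma ncb_adj_irr m n k : irreflexive (@ncb_adj m n k).
Proof. by case. Qed.

Definition nearly_complete_bipartite (m n k : nat) : simple_graph :=
  SimpleGraph (@ncb_adj_sym m n k) (@ncb_adj_irr m n k).

Definition homeomorphism (T U : topologicalType) (A : set T) (B : set U)
    (f : T -> U) : Prop :=
  [/\ set_bij A B f, {within A, continuous f} &
      exists2 g : U -> T, {within B, continuous g} & {in A, cancel f g}].

Section Surfaces.
Variable R : realType.

Definition unit_disk : set (R * R) := [set p | p.1 ^+ 2 + p.2 ^+ 2 < 1].

Definition closed_square : set (R * R) := `[0, 1] `*` `[0, 1].
Definition open_square : set (R * R) := `]0, 1[ `*` `]0, 1[.

Definition open_disk (S : topologicalType) (U : set S) : Prop :=
  exists f : R * R -> S, homeomorphism unit_disk U f.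

(* Second countability is not required separately: it follows from compactness
   and the existence of the disk neighbourhoods. *)
Definition closed_surface (S : topologicalType) : Prop :=
  [/\ hausdorff_space S, compact [set: S], connected [set: S] &
      forall x : S, exists U : set S, [/\ open U, U x & open_disk U]].

(* The Moebius band is the quotient of the closed unit square by
   (0, t) ~ (1, 1 - t). *)
Definition moebius_rel (p q : R * R) : Prop :=
  [\/ p = q,
      [/\ p.1 = 0, q.1 = 1 & q.2 = 1 - p.2] |
      [/\ q.1 = 0, p.1 = 1 & p.2 = 1 - q.2]].

(* Nonorientable: S contains a Moebius band. A continuous map from the square
   whose fibres are the classes of [moebius_rel] induces a continuous injection
   of the (compact) Moebius band into S, which is a homeomorphism onto its
   image when S is Hausdorff. *)
Definition nonorientable (S : topologicalType) : Prop :=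
  exists f : R * R -> S,
    {within closed_square, continuous f} /\
    forall p q, closed_square p -> closed_square q ->
      (f p = f q <-> moebius_rel p q).

(* [arc u v], relevant only when u and v are adjacent and only on [0, 1],
   parametrizes the edge uv from u to v; [arc v u] is the same curve
   reversed. *)
Record graph_embedding (G : simple_graph) (S : topologicalType) :=
  GraphEmbedding {
  pt : vertex G -> S;
  arc : vertex G -> vertex G -> R -> S;
  pt_inj : injective pt;
  arc_continuous : forall u v, adj u v ->
    {within `[0, 1], continuous (arc u v)};
  arc_inj : forall u v, adj u v -> set_inj `[0, 1] (arc u v);
  arc_start : forall u v, adj u v -> arc u v 0 = pt u;
  arc_end : forall u v, adj u v -> arc u v 1 = pt v;
  arc_reverse : forall u v t, adj u v -> t \in `[0, 1] ->
    arc v u t = arc u v (1 - t);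
  arc_avoids_pt : forall u v w t, adj u v -> t \in `]0, 1[ ->
    arc u v t <> pt w;
  arc_disjoint : forall u v u' v' t t', adj u v -> adj u' v' ->
    t \in `]0, 1[ -> t' \in `]0, 1[ -> arc u v t = arc u' v' t' ->
    (u = u' /\ v = v') \/ (u = v' /\ v = u') }.

Section Faces.
Variables (G : simple_graph) (S : topologicalType) (E : graph_embedding G S).

Definition graph_image : set S :=
  [set x | (exists v, x = pt E v) \/
           (exists u v t, [/\ adj u v, t \in `[0, 1] & x = arc E u v t])].

Definition face (F : set S) : Prop :=
  exists2 x, ~ graph_image x & F = connected_component (~` graph_image) x.

Definition cellular : Prop := forall F, face F -> open_disk F.

(* The closed walk v0 v1 v2 v3 v0 bounds F: a continuous map from a closed
   quadrilateral sends its interior homeomorphically onto F while its four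
   sides, in cyclic order, traverse the edges of the walk. Vertices and edges
   may be repeated along the walk. Prescribing the parametrization of the sides
   loses no generality, since a self-homeomorphism of the quadrilateral
   reparametrizes its sides independently. *)
Definition bounded_by_walk4 (F : set S) (v0 v1 v2 v3 : vertex G) : Prop :=
  [/\ adj v0 v1, adj v1 v2, adj v2 v3, adj v3 v0 &
      exists phi : R * R -> S,
        [/\ {within closed_square, continuous phi},
            homeomorphism open_square F phi &
            forall t, t \in `[0, 1] ->
              [/\ phi (t, 0) = arc E v0 v1 t,
                  phi (1, t) = arc E v1 v2 t,
                  phi (1 - t, 1) = arc E v2 v3 t &
                  phi (0, 1 - t) = arc E v3 v0 t]]].

Definition quadrangular : Prop :=
  cellular /\
  forall F, face F -> exists v0 v1 v2 v3, bounded_by_walk4 F v0 v1 v2 v3.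

End Faces.

Definition has_nonorientable_quadrangular_embedding (G : simple_graph) : Prop :=
  exists (S : topologicalType) (E : graph_embedding G S),
    [/\ closed_surface S, nonorientable S & quadrangular E].

End Surfaces.

(* Main.v *)
(* The graph is quadrangulated as follows. Number the white vertices 0, ..., 2n
   and the black ones 0, ..., 2n-1, and let tau and sigma be the two perfect
   matchings {2i, 2i+1} and {2i-1, 2i} (mod 2n) of the cycle of length 2n. The
   products of two tau-edges, or of two sigma-edges, form a quadrangulation of
   K_{2n,2n} by a torus-like grid. Removing the edges xx deletes the diagonal
   products, and the white vertex 2n is coned over the resulting faces through
   the quadrilaterals {x, 2n} x {tau x, sigma x}. The link of 2n then consists
   of two cycles; replacing five quadrilaterals by five others merges them and
   makes the surface nonorientable.

   The surface is realised as the polyhedron, in barycentric coordinates, of the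
   simplicial complex obtained by coning every quadrilateral from its centre.
   Open stars of vertices are open disks, because links are cycles and the cone
   over a cycle is a complete fan in the plane. Faces are the open stars of the
   centres. The Moebius band is a strip crossing four quadrilaterals. *)
Require Import Defs.
From mathcomp Require Import all_boot all_order all_algebra.
From mathcomp Require Import all_classical all_reals all_analysis.
From mathcomp Require Import ring lra zify.
Import Order.TTheory GRing.Theory Num.Theory.
Import numFieldNormedType.Exports.

Set Implicit Arguments.
Unset Strict Implicit.
Unset Printing Implicit Defensive.

(** * The combinatorial quadrangulation *)

(** Both [tau w] and [sigma w] have the parity opposite to that of [w], so the apex quadrilaterals
    split the link of [2 * n] into a cycle through the even black vertices and a cycle through the
    odd ones. The exchange drops the apex quadrilaterals of 3 and 4, which join 2 to 4 and 3 to 5 in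
    this link, and its new quadrilaterals at [2 * n] join 2 to 3 and 4 to 5 instead: the two cycles
    become one. Three tiles are exchanged along with them so that every edge keeps exactly two
    faces. Apart from [2 * n] the exchange only involves labels up to 5, which is where [n >= 3]
    enters. The combinatorial core consists of two facts, from which all links are cycles: each edge
    lies on exactly two faces ([two_oppositesP]), and the faces around a vertex are connected
    through shared edges ([white_connect], [black_connect]). *)

Section Opposite.
Variable n : nat.
Hypothesis n_ge3 : 3 <= n.

Definition tau x := if odd x then x.-1 else x.+1.
Definition sigma x := if odd x then (if x == (2 * n).-1 then 0 else x.+1)
  else if x == 0 then (2 * n).-1 else x.-1.

Lemma tau_lt x : x < 2 * n -> tau x < 2 * n.
Proof. by rewrite /tau; case: ifP; lia. Qed.
Lemma sigma_lt x : x < 2 * n -> sigma x < 2 * n.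
Proof. by rewrite /sigma; case: ifP => ?; case: eqP; lia. Qed.
Lemma tauK x : tau (tau x) = x.
Proof. by rewrite /tau; case: (boolP (odd x)) => ?; case: ifP; lia. Qed.
Lemma sigmaP x : x < 2 * n ->
  (x = 0 /\ sigma x = (2 * n).-1) \/ (x = (2 * n).-1 /\ sigma x = 0) \/
  (odd x /\ x < (2 * n).-1 /\ sigma x = x.+1) \/ (~~ odd x /\ 0 < x /\ sigma x = x.-1).
Proof. by move=> ?; rewrite /sigma; case: (boolP (odd x)) => ?; case: eqP => ?; lia. Qed.
Lemma sigmaK x : x < 2 * n -> sigma (sigma x) = x.
Proof. by move=> xn; have := sigmaP xn; have := sigmaP (sigma_lt xn); lia. Qed.
Lemma tau_neq x : tau x <> x.
Proof. by rewrite /tau; case: ifP; lia. Qed.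
Lemma sigma_neq x : x < 2 * n -> sigma x <> x.
Proof. by move=> ?; rewrite /sigma; case: ifP => ?; case: eqP; lia. Qed.
Lemma tau_sigma x : x < 2 * n -> tau x <> sigma x.
Proof. by move=> ?; rewrite /sigma /tau; case: ifP => ?; case: eqP; lia. Qed.
Lemma sigma1 : sigma 1 = 2. Proof. by rewrite /sigma /=; case: eqP; lia. Qed.
Lemma sigma2 : sigma 2 = 1. Proof. by []. Qed.
Lemma sigma3 : sigma 3 = 4. Proof. by rewrite /sigma /=; case: eqP; lia. Qed.
Lemma sigma4 : sigma 4 = 3. Proof. by []. Qed.

(* [removed_tile], the exclusion of 3 and 4 in [apex], and [added] encode the
   exchange of five quadrilaterals that connects the link of 2n. *)
Definition removed_tile x y := (x <= 1) && (2 <= y <= 5) || (2 <= x <= 3) && (4 <= y <= 5).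

(** As [tau] is an involution, the two inequalities say that none of the four sides is a deleted
    edge [xx]. The same holds for [square] with [sigma]. *)
Definition tile x y x' y' := [/\ x < 2 * n /\ y < 2 * n, x <> y, x <> tau y,
  ~~ removed_tile x y & x' = tau x /\ y' = tau y].

Definition square x y x' y' := [/\ x < 2 * n /\ y < 2 * n, x <> y, x <> sigma y &
  x' = sigma x /\ y' = sigma y].

Definition apex x y x' y' := exists w, [/\ w < 2 * n, w <> 3, w <> 4,
  x = w /\ x' = 2 * n \/ x = 2 * n /\ x' = w &
  y = tau w /\ y' = sigma w \/ y = sigma w /\ y' = tau w].

Definition pairs2 (a a' b b' x y x' y' : nat) :=
  (x = a /\ x' = a' \/ x = a' /\ x' = a) /\ (y = b /\ y' = b' \/ y = b' /\ y' = b).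

(** Counted with multiplicity, these five quadrilaterals have the same twenty sides as the three
    removed tiles and the apex quadrilaterals of 3 and 4; the edge from white 3 to black 4 occurs
    twice in both lists. Hence the exchange preserves the number of faces on every edge. *)
Definition added x y x' y' :=
  pairs2 0 (2 * n) 2 3 x y x' y' \/ pairs2 1 3 2 4 x y x' y' \/
  pairs2 1 4 3 5 x y x' y' \/ pairs2 0 3 4 5 x y x' y' \/ pairs2 2 (2 * n) 4 5 x y x' y'.

(* [opposite x y x' y']: the quadrilateral with white vertices x, x' and black
   vertices y, y' is a face. *)
Definition opposite x y x' y' :=
  tile x y x' y' \/ square x y x' y' \/ apex x y x' y' \/ added x y x' y'.

Lemma removed_tau x y : removed_tile (tau x) y = removed_tile x y.
Proof. by rewrite /removed_tile /tau; case: ifP; lia. Qed.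
Lemma removed_tau2 x y : removed_tile x (tau y) = removed_tile x y.
Proof. by rewrite /removed_tile /tau; case: ifP; lia. Qed.

(** With the two lemmas that follow, a quadrilateral may be read from any of its four corners. *)
Lemma opposite_swap x y x' y' : opposite x y x' y' -> opposite x' y' x y.
Proof.
case=> [[[xn yn] xy xty r [-> ->]]|[[[xn yn] xy xsy [-> ->]]|[[w [wn w3 w4 hx hy]]|h]]].
- left; split; rewrite ?tauK ?removed_tau ?removed_tau2//; first by rewrite !tau_lt.
    by move=> /(congr1 tau); rewrite !tauK.
  by move=> xE; apply: xty; rewrite -xE tauK.
- right; left; split; rewrite ?sigmaK//; first by rewrite !sigma_lt.
    by move=> /(congr1 sigma); rewrite !sigmaK.
  by move=> xE; apply: xsy; rewrite -xE sigmaK.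
- right; right; left; exists w; split=> //; first by case: hx => -[-> ->]; [right|left].
  by case: hy => -[-> ->]; [right|left].
- right; right; right; move: h; rewrite /added /pairs2; tauto.
Qed.

Lemma opposite_swapl x y x' y' : opposite x y x' y' -> opposite x' y x y'.
Proof.
case=> [[[xn yn] xy xty r [-> ->]]|[[[xn yn] xy xsy [-> ->]]|[[w [wn w3 w4 hx hy]]|h]]].
- left; split; rewrite ?tauK ?removed_tau//; first by rewrite !tau_lt.
    by move=> xE; apply: xty; rewrite -xE tauK.
  by move=> /(congr1 tau); rewrite !tauK.
- right; left; split; rewrite ?sigmaK//; first by rewrite !sigma_lt.
    by move=> xE; apply: xsy; rewrite -xE sigmaK.
  by move=> /(congr1 sigma); rewrite !sigmaK.
- right; right; left; exists w; split=> //; by case: hx => -[-> ->]; [right|left].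
- right; right; right; move: h; rewrite /added /pairs2; tauto.
Qed.

Lemma opposite_swapr x y x' y' : opposite x y x' y' -> opposite x y' x' y.
Proof. by move=> /opposite_swapl/opposite_swap. Qed.

Lemma opposite_edge x y x' y' : opposite x y x' y' ->
  [/\ x <= 2 * n, y < 2 * n, x <> y, x' <> x & y' <> y].
Proof.
case=> [[[xn yn] xy xty r [-> ->]]|[[[xn yn] xy xsy [-> ->]]|[[w [wn w3 w4 hx hy]]|h]]].
- by split=> //; [exact: ltnW|exact: tau_neq|exact: tau_neq].
- by split=> //; [exact: ltnW|exact: sigma_neq|exact: sigma_neq].
- have tw := tau_lt wn; have sw := sigma_lt wn; have ts := tau_sigma wn.
  have tn := @tau_neq w; have sn := sigma_neq wn.
  by case: hx hy => -[-> ->] [[-> ->]|[-> ->]]; split; lia.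
- by move: h; rewrite /added /pairs2 => h; split; lia.
Qed.

(* The edges all or some of whose faces are affected by the exchange. *)
Definition modified x y := [|| removed_tile x y, (x == 3) && ((y == 2) || (y == 4)),
  (x == 4) && ((y == 3) || (y == 5)) | (x == 2 * n) && (2 <= y <= 5)].

Lemma added_modified x y x' y' : added x y x' y' -> modified x y.
Proof. by rewrite /added /pairs2 /modified /removed_tile; lia. Qed.

(** A quadrilateral with side [xy] is determined by its other two corners, so this expresses that
    the edge lies on exactly two faces. *)
Definition two_opposites x y := exists p q : nat * nat, p <> q /\
  forall x' y', opposite x y x' y' <-> (x', y') = p \/ (x', y') = q.

(** In general the two faces are a tile and a square. If [y = tau x] the tile would contain deleted
    edges, if [y = sigma x] the square would, and the apex quadrilateral of [x] takes its place. *)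
Lemma two_opposites_unmodified x y : x < 2 * n -> y < 2 * n -> x <> y ->
  ~~ modified x y -> two_opposites x y.
Proof.
move=> xn yn xy nm.
have nr : ~~ removed_tile x y by apply: contra nm; rewrite /modified => ->.
have nadd x' y' : ~ added x y x' y' by move=> /added_modified; apply/negP.
have apexE x' y' : apex x y x' y' -> x' = 2 * n /\
    (y = tau x /\ y' = sigma x \/ y = sigma x /\ y' = tau x).
  by move=> [w [wn w3 w4 [[-> ->]|[xE _]] hy]]; [split|lia].
have [ty|ty] := eqVneq y (tau x).
  have x34 : x <> 3 /\ x <> 4 by move: nm ty; rewrite /modified /tau; case: ifP; lia.
  exists (sigma x, sigma y), (2 * n, sigma x); split; first by case; have := sigma_lt xn; lia.
  move=> x' y'; split=> [[[_ _ xty]|[[_ _ _ [-> ->]]|[/apexE[-> [[_ ->]|[yE _]]]|/nadd//]]]|].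
  - by case: xty; rewrite ty tauK.
  - by left.
  - by right.
  - by case: (tau_sigma xn); rewrite -ty.
  case=> -[-> ->].
    right; left; split=> // xsy; case: (tau_sigma xn).
    by rewrite -ty xsy sigmaK.
  by right; right; left; exists x; case: x34; split=> //; left.
have [sy|sy] := eqVneq y (sigma x).
  have x34 : x <> 3 /\ x <> 4.
    by split=> xE; move: nm sy; rewrite xE /modified ?sigma3 ?sigma4; lia.
  exists (tau x, tau y), (2 * n, tau x); split; first by case; have := tau_lt xn; lia.
  move=> x' y'; split=> [[[_ _ _ _ [-> ->]]|[[_ _ xsy]|[/apexE[-> [[yE _]|[_ ->]]]|/nadd//]]]|].
  - by left.
  - by case: xsy; rewrite sy sigmaK.
  - by move/eqP: ty.
  - by right.
  case=> -[-> ->].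
    left; split=> // xty; case: (tau_sigma xn).
    by rewrite -sy xty tauK.
  by right; right; left; exists x; case: x34; split=> //; [left|right].
exists (tau x, tau y), (sigma x, sigma y); split.
  by case=> + _; exact: tau_sigma.
move=> x' y'; split=> [[[_ _ _ _ [-> ->]]|[[_ _ _ [-> ->]]|[/apexE[_ [[yE _]|[yE _]]]|/nadd//]]]|].
- by left.
- by right.
- by move/eqP: ty.
- by move/eqP: sy.
case=> -[-> ->]; [left|right; left]; split=> //.
  by move=> xE; move/eqP: ty; rewrite xE tauK.
by move=> xE; move/eqP: sy; rewrite xE sigmaK.
Qed.

(** The apex quadrilaterals that contain [y] are those of [tau y] and [sigma y]. For [y] from 2 to 5
    exactly one of these two is 3 or 4, and an added quadrilateral replaces it. *)
Lemma two_opposites_apex y : y < 2 * n -> two_opposites (2 * n) y.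
Proof.
move=> yn; have tn := tau_lt yn; have sn := sigma_lt yn.
have apexE x' y' : apex (2 * n) y x' y' <-> x' <> 3 /\ x' <> 4 /\
    (x' = tau y /\ y' = sigma (tau y) \/ x' = sigma y /\ y' = tau (sigma y)).
  split=> [[w [wn w3 w4 [[wE _]|[_ ->]] [[-> ->]|[-> ->]]]]|].
  - by lia.
  - by lia.
  - by do 2!split=> //; left; rewrite tauK.
  - by do 2!split=> //; right; rewrite sigmaK.
  move=> [x3 [x4 [[xE yE]|[xE yE]]]]; exists x'; subst.
    by split=> //; [right|left; rewrite tauK].
  by split=> //; [right|right; rewrite sigmaK].
have oppE x' y' : opposite (2 * n) y x' y' <-> apex (2 * n) y x' y' \/ added (2 * n) y x' y'.
  rewrite /opposite; split; last tauto.
  by case=> [[]|[[]|]]; try lia; tauto.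
have gen : ~~ (2 <= y <= 5) -> two_opposites (2 * n) y.
  move=> y25; have nadd x' y' : ~ added (2 * n) y x' y'.
    by move=> /added_modified; rewrite /modified /removed_tile; lia.
  have t34 : tau y <> 3 /\ tau y <> 4 by rewrite /tau; case: ifP; lia.
  have s34 : sigma y <> 3 /\ sigma y <> 4.
    by rewrite /sigma; case: ifP => ?; case: eqP; lia.
  exists (tau y, sigma (tau y)), (sigma y, tau (sigma y)); split.
    by case=> + _; exact: tau_sigma.
  move=> x' y'; rewrite oppE apexE; split.
    by case=> [[_ [_ [[-> ->]|[-> ->]]]]|/nadd//]; [left|right].
  by case: t34 s34 => ? ? [? ?]; case=> -[-> ->]; left; do 2!split=> //; [left|right].
have [y25|] := boolP (2 <= y <= 5); last exact: gen.
have [?|[?|[?|?]]] : y = 2 \/ y = 3 \/ y = 4 \/ y = 5 by lia.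
all: subst y.
- exists (1, 0), (0, 3); split=> // x' y'; rewrite oppE apexE sigma2 /tau /= ?sigma3.
  rewrite /added /pairs2; split=> [h|[[-> ->]|[-> ->]]]; [|lia|lia].
  have : (x' = 1 /\ y' = 0) \/ (x' = 0 /\ y' = 3) by lia.
  by case=> -[-> ->]; [left|right].
- exists (2, 1), (0, 2); split=> // x' y'; rewrite oppE apexE sigma3 /tau /= ?sigma2.
  rewrite /added /pairs2; split=> [h|[[-> ->]|[-> ->]]]; [|lia|lia].
  have : (x' = 2 /\ y' = 1) \/ (x' = 0 /\ y' = 2) by lia.
  by case=> -[-> ->]; [left|right].
- exists (5, sigma 5), (2, 5); split=> // x' y'; rewrite oppE apexE sigma4 /tau /=.
  rewrite /added /pairs2; split=> [h|[[-> ->]|[-> ->]]]; [|lia|lia].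
  have : (x' = 5 /\ y' = sigma 5) \/ (x' = 2 /\ y' = 5) by lia.
  by case=> -[-> ->]; [left|right].
- have s5 : sigma 5 = 6 \/ sigma 5 = 0 by rewrite /sigma /=; case: eqP; tauto.
  exists (sigma 5, tau (sigma 5)), (2, 4); split; first by case; lia.
  move=> x' y'; rewrite oppE apexE /added /pairs2.
  have -> : tau 5 = 4 by [].
  split=> [h|[[-> ->]|[-> ->]]]; [|lia|lia].
  have : (x' = sigma 5 /\ y' = tau (sigma 5)) \/ (x' = 2 /\ y' = 4) by lia.
  by case=> -[-> ->]; [left|right].
Qed.


Lemma oppositeE x y x' y' : x < 2 * n -> y < 2 * n -> x <> y -> opposite x y x' y' <->
  (x <> tau y /\ ~~ removed_tile x y /\ x' = tau x /\ y' = tau y) \/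
  (x <> sigma y /\ x' = sigma x /\ y' = sigma y) \/
  (x <> 3 /\ x <> 4 /\ x' = 2 * n /\
    (y = tau x /\ y' = sigma x \/ y = sigma x /\ y' = tau x)) \/
  added x y x' y'.
Proof.
move=> xn yn xy; split.
  case=> [[_ _ ? ? [? ?]]|[[_ _ ? [? ?]]|[[w [wn w3 w4 [[xw xw']|[xE _]] hy]]|h]]].
  - by left.
  - by right; left.
  - by right; right; left; subst w.
  - by lia.
  - by right; right; right.
case=> [[? [? [? ?]]]|[[? [? ?]]|[[x3 [x4 [xE hy]]]|h]]].
- by left.
- by right; left.
- by right; right; left; exists x; split=> //; left.
- by right; right; right.
Qed.

Ltac split_hyps := repeat match goal with
  | H : _ /\ _ |- _ => destruct H
  | H : _ \/ _ |- _ => destruct H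
  end.

Ltac solve_prop := match goal with
  | |- _ \/ _ => first [solve [left; solve_prop] | right; solve_prop]
  | |- _ /\ _ => split; solve_prop
  | |- _ => first [by [] | lia]
  end.

(** Settles one concrete edge whose opposite corners are [(a, b)] and [(c, d)]: once the known
    values of [tau] and [sigma] are substituted, only linear arithmetic is left. *)
Ltac cell a b c d :=
  exists (a, b), (c, d); split; [by case; lia|];
  let x' := fresh "x'" in let y' := fresh "y'" in let h := fresh "h" in
  move=> x' y'; rewrite oppositeE; [|lia|lia|lia];
  rewrite /added /pairs2 /removed_tile;
  repeat match goal with E : tau _ = _ |- _ => rewrite ?E; clear E
    | E : sigma _ = _ |- _ => rewrite ?E; clear E end;
  split=> [h|[[-> ->]|[-> ->]]]; [|solve_prop|solve_prop];
  split_hyps; first [discriminate | exfalso; lia |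
    left; congr pair; lia | right; congr pair; lia].

Lemma two_opposites_modified x y : x < 2 * n -> modified x y -> x <> y -> two_opposites x y.
Proof.
move=> xn m xy.
have s0 : sigma 0 = (2 * n).-1 by [].
have s5 : (sigma 5 = 6 /\ 3 < n) \/ (sigma 5 = 0 /\ n = 3) by have := @sigmaP 5; lia.
have [t0 t1] : tau 0 = 1 /\ tau 1 = 0 by []. 
have [t2 t3] : tau 2 = 3 /\ tau 3 = 2 by [].
have [t4 t5] : tau 4 = 5 /\ tau 5 = 4 by [].
have s1 := sigma1; have s2 := sigma2; have s3 := sigma3; have s4 := sigma4.
move: m; rewrite /modified /removed_tile => m.
have : x = 0 \/ x = 1 \/ x = 2 \/ x = 3 \/ x = 4 by lia.
case=> [?|[?|[?|[?|?]]]]; subst x.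
- have : y = 2 \/ y = 3 \/ y = 4 \/ y = 5 by lia.
  case=> [?|[?|[?|?]]]; subst y; clear m.
  + by cell (2 * n) 3 ((2 * n).-1) 1.
  + by cell (2 * n) 2 ((2 * n).-1) 4.
  + by cell 3 5 ((2 * n).-1) 3.
  (* For [n = 3] one has [sigma 0 = 5], so the square on this edge is diagonal and the apex
     quadrilateral of 0 replaces it. *)
  + case: s5 => -[s5 n3]; first by cell 3 4 ((2 * n).-1) 6.
    by cell 3 4 (2 * n) 1.
- have : y = 2 \/ y = 3 \/ y = 4 \/ y = 5 by lia.
  case=> [?|[?|[?|?]]]; subst y; clear m.
  + by cell 3 4 (2 * n) 0.
  + by cell 4 5 2 4.
  + by cell 3 2 2 3.
  + by cell 4 3 2 (sigma 5).
- have : y = 4 \/ y = 5 by lia.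
  case=> [?|?]; subst y; clear m.
  + by cell (2 * n) 5 1 3.
  + by cell (2 * n) 4 1 (sigma 5).
- have : y = 2 \/ y = 4 \/ y = 5 by lia.
  case=> [?|[?|?]]; subst y; clear m.
  + by cell 1 4 4 1.
  + by cell 1 2 0 5.
  + by cell 0 4 4 (sigma 5).
- have : y = 3 \/ y = 5 by lia.
  case=> [?|?]; subst y; clear m.
  + by cell 5 2 1 5.
  + by cell 1 3 3 (sigma 5).
Qed.

Lemma two_oppositesP x y : x <= 2 * n -> y < 2 * n -> x <> y -> two_opposites x y.
Proof.
move=> xn yn xy; have [->|/eqP xE] := eqVneq x (2 * n); first exact: two_opposites_apex.
have {xE}xn : x < 2 * n by lia.
have [m|m] := boolP (modified x y); first exact: two_opposites_modified.
exact: two_opposites_unmodified.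
Qed.

(** * Connectedness of the faces around a vertex *)

Section Connection.
Variable P : nat -> Prop.

Lemma iff_chain (lo hi : nat) : (forall i, lo <= i -> i.+1 < hi -> (P i <-> P i.+1)) ->
  forall a, lo <= a < hi -> (P lo <-> P a).
Proof.
move=> step; elim=> [|a IH] /andP[la ah]; first by have -> : lo = 0 by lia.
have [->//|la'] := eqVneq lo a.+1.
by rewrite IH; [apply: step; lia|lia].
Qed.

(** For [x < 2 * n], tiles and squares join consecutive black vertices into a row with a gap at [x],
    and a quadrilateral joining [x.-1] to [x.+1] closes the gap. An arbitrary invariant [P] is used
    so that reachability between faces can be substituted for it later. *)
Lemma white_connect x : x <= 2 * n ->
  (forall y y' x', opposite x y x' y' -> P y -> P y') ->
  forall y0 y, y0 < 2 * n -> y < 2 * n -> x <> y0 -> x <> y -> P y0 -> P y.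
Proof.
move=> xn clos y0 y y0n yn xy0 xy.
have E b b' x' : opposite x b x' b' -> P b <-> P b'.
  by move=> h; split; [exact: clos h|exact: clos (opposite_swapr h)].
have Enew b b' x' : added x b x' b' -> P b <-> P b'.
  by move=> h; apply: (E _ _ x'); right; right; right.
have Eapex w : w < 2 * n -> w <> 3 -> w <> 4 -> x = w \/ x = 2 * n ->
    P (tau w) <-> P (sigma w).
  move=> wn w3 w4 [xE|xE].
    by apply: (E _ _ (2 * n)); right; right; left; exists w; split=> //; left.
  by apply: (E _ _ w); right; right; left; exists w; split=> //; [right|left].
(* Squares give the steps from odd [i] and are never removed; tiles give those from even [i]. *)
have Estep i : x < 2 * n -> i.+1 < 2 * n -> x <> i -> x <> i.+1 ->
    odd i \/ ~~ removed_tile x i -> (P i <-> P i.+1).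
  move=> xn' iN xi xi1 ri; have [oi|oi] := boolP (odd i).
    have si : sigma i = i.+1 by have := @sigmaP i; lia.
    have s1 : sigma i.+1 = i by rewrite -si sigmaK; lia.
    by apply: (E _ _ (sigma x)); right; left; split; rewrite ?si//; lia.
  have ti : tau i = i.+1 by rewrite /tau (negbTE oi).
  have t1 : tau i.+1 = i by rewrite -ti tauK.
  by apply: (E _ _ (tau x)); left; split; rewrite ?ti//; lia.
have [xE|xE] := eqVneq x (2 * n).
  (* [i] and [i.+2] are the two neighbours of [i.+1], joined by its apex quadrilateral; [i = 2, 3]
     belong to the dropped ones. As 2-4 and 3-5 are cut, 4 and 5 are reached the long way round,
     through the last even and the last odd label, and the two parities meet in the added 2-3. *)
  have two i : i.+2 < 2 * n -> i <> 2 -> i <> 3 -> P i <-> P i.+2.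
    move=> iN i2 i3.
    have H : P (tau i.+1) <-> P (sigma i.+1) by apply: Eapex; [lia|lia|lia|right].
    have sE := sigmaP (ltnW iN); have [oi|oi] := boolP (odd i).
      have [tE sE'] : tau i.+1 = i.+2 /\ sigma i.+1 = i by rewrite /tau; case: ifP; lia.
      by rewrite tE sE' in H; symmetry.
    have [tE sE'] : tau i.+1 = i /\ sigma i.+1 = i.+2 by rewrite /tau; case: ifP; lia.
    by rewrite tE sE' in H.
  have E0 : P 0 <-> P (2 * n).-2.
    have H : P (tau (2 * n).-1) <-> P (sigma (2 * n).-1) by apply: Eapex; [lia|lia|lia|right].
    have sE := @sigmaP (2 * n).-1.
    have [tE sE'] : tau (2 * n).-1 = (2 * n).-2 /\ sigma (2 * n).-1 = 0.
      by rewrite /tau; case: ifP; lia.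
    by rewrite tE sE' in H; symmetry.
  have E1 : P 1 <-> P (2 * n).-1.
    by apply: (Eapex 0) => //; [lia|right].
  have E02 : P 0 <-> P 2 by apply: two; lia.
  have E13 : P 1 <-> P 3 by apply: two; lia.
  have E23 : P 2 <-> P 3 by apply: (Enew _ _ 0); rewrite /added /pairs2; lia.
  have ev k : k.*2 < 2 * n -> 4 <= k.*2 -> P 4 <-> P k.*2.
    elim: k => // k IH kn k4; have [->//|k3] := eqVneq k.+1 2.
    rewrite IH; [|lia|lia].
    by rewrite doubleS; apply: two; lia.
  have od k : k.*2.+1 < 2 * n -> 5 <= k.*2.+1 -> P 5 <-> P k.*2.+1.
    elim: k => // k IH kn k4; have [->//|k3] := eqVneq k.+1 2.
    rewrite IH; [|lia|lia].
    by rewrite doubleS; apply: two; lia.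
  have e4 : P 4 <-> P 0.
    rewrite E0; have := @ev n.-1; rewrite (_ : n.-1.*2 = (2 * n).-2); last lia.
    by apply; lia.
  have e5 : P 5 <-> P 1.
    rewrite E1; have := @od n.-1; rewrite (_ : n.-1.*2.+1 = (2 * n).-1); last lia.
    by apply; lia.
  have all z : z < 2 * n -> P 0 <-> P z.
    move=> zn; have zE := odd_double_half z; have [z4|z4] := ltnP z 4.
      have : z = 0 \/ z = 1 \/ z = 2 \/ z = 3 by lia.
      by case=> [?|[?|[?|?]]]; subst z; tauto.
    have [oz|oz] := boolP (odd z).
      have {}zE : z = z./2.*2.+1 by lia.
      have h : P 5 <-> P z by rewrite zE; apply: od; lia.
      tauto.
    have {}zE : z = z./2.*2 by lia.
    have h : P 4 <-> P z by rewrite zE; apply: ev; lia.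
    tauto.
  by move=> Py0; apply/(all _ yn)/(all _ y0n).
have {xE xn}xn : x < 2 * n by move/eqP: xE; lia.
(* Among the white vertices below [2 * n], only 1 has a row out of order: 0, 2, 4, 3, 5, 6, and so
   on. *)
have [x1|x1] := eqVneq x 1.
  subst x; have a02 : P 0 <-> P 2.
    by have := Eapex 1; rewrite sigma1; apply=> //; left.
  have a24 : P 2 <-> P 4 by apply: (Enew _ _ 3); rewrite /added /pairs2; lia.
  have a34 : P 3 <-> P 4 by apply: Estep; lia.
  have a35 : P 3 <-> P 5 by apply: (Enew _ _ 4); rewrite /added /pairs2; lia.
  have ch a : 5 <= a < 2 * n -> P 5 <-> P a.
    by apply: iff_chain => i i5 iN; apply: Estep; rewrite /removed_tile; lia.
  have all z : z < 2 * n -> 1 <> z -> P 5 <-> P z.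
    move=> zn z1; have [z5|z5] := leqP 5 z; first by apply: ch; rewrite z5.
    have : z = 0 \/ z = 2 \/ z = 3 \/ z = 4 by lia.
    by case=> [->|[->|[->|->]]]; tauto.
  by move=> Py0; apply/(all _ yn xy)/(all _ y0n xy0).
have step i : i.+1 < 2 * n -> x <> i -> x <> i.+1 -> P i <-> P i.+1.
  move=> iN xi xi1; have [oi|oi] := boolP (odd i); first by apply: Estep => //; left.
  have [r|r] := boolP (removed_tile x i); last by apply: Estep => //; right.
  have : x = 0 /\ i = 2 \/ x = 0 /\ i = 4 \/ x = 2 /\ i = 4 \/ x = 3 /\ i = 4.
    by move: r oi; rewrite /removed_tile; move/eqP: x1; lia.
  case=> [[xE ->]|[[xE ->]|[[xE ->]|[xE ->]]]].
  - by apply: (Enew _ _ (2 * n)); rewrite /added /pairs2; lia.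
  - by apply: (Enew _ _ 3); rewrite /added /pairs2; lia.
  - by apply: (Enew _ _ (2 * n)); rewrite /added /pairs2; lia.
  - by apply: (Enew _ _ 0); rewrite /added /pairs2; lia.
(* The gap at [x] is crossed by the apex quadrilateral of [x], or by an added one for [x = 3, 4]. *)
have bridge : 0 < x -> x.+1 < 2 * n -> P x.-1 <-> P x.+1.
  move=> x0 xN; have [x3|x3] := eqVneq x 3.
    by rewrite x3; apply: (Enew _ _ 1); rewrite /added /pairs2; lia.
  have [x4|x4] := eqVneq x 4.
    by rewrite x4; apply: (Enew _ _ 1); rewrite /added /pairs2; lia.
  have := @Eapex x xn; have := sigmaP xn; rewrite /tau.
  case: (boolP (odd x)) => ox sE H.
    have <- : sigma x = x.+1 by lia.
    by apply: H; [exact/eqP|exact/eqP|left].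
  have <- : sigma x = x.-1 by lia.
  by split; apply H; try (exact/eqP); left.
have lo a : a < x -> P 0 <-> P a.
  by move=> ax; apply: (@iff_chain 0 x) => // i _ ix; apply: step; lia.
have hi a : x < a -> a < 2 * n -> P x.+1 <-> P a.
  move=> xa an; apply: (@iff_chain x.+1 (2 * n)); last lia.
  by move=> i ix iN; apply: step; lia.
have all a b : a < b -> b < 2 * n -> x <> a -> x <> b -> P a <-> P b.
  move=> ab bn xa xb; have [bx|bx] := ltnP b x; first by rewrite -(lo a) ?(lo b)//; lia.
  have [ax|ax] := ltnP x a; first by rewrite -(hi a) ?(hi b)//; lia.
  have xb' : x < b by lia.
  have x0 : 0 < x by lia.
  rewrite -(hi b) // -(lo a); last lia.
  by rewrite -bridge; [apply: lo|..]; lia.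
have [yy|yy|->//] := ltngtP y0 y; first by move=> h; apply/(all _ _ yy).
by move=> h; apply/(all _ _ yy).
Qed.

(** For [y] outside 2 to 5 the white vertices below [2 * n] form a row with a gap at [y], and the
    vertices on either side of the gap are joined to [2 * n] by the apex quadrilaterals of [tau y]
    and [sigma y]. For [y] from 2 to 5 the exchange alters the row, and each case is followed by
    hand. *)
Lemma black_connect y : y < 2 * n ->
  (forall x x' y', opposite x y x' y' -> P x -> P x') ->
  forall x0 x, x0 <= 2 * n -> x <= 2 * n -> x0 <> y -> x <> y -> P x0 -> P x.
Proof.
move=> yn clos x0 x x0n xn xy0 xy.
have E b b' y' : opposite b y b' y' -> P b <-> P b'.
  by move=> h; split; [exact: clos h|exact: clos (opposite_swapl h)].
have Enew b b' y' : added b y b' y' -> P b <-> P b'.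
  by move=> h; apply: (E _ _ y'); right; right; right.
have Etau : tau y <> 3 -> tau y <> 4 -> P (2 * n) <-> P (tau y).
  move=> w3 w4; apply: (E _ _ (sigma (tau y))); right; right; left.
  by exists (tau y); split; rewrite ?tauK ?tau_lt//; [right|left].
have Esigma : sigma y <> 3 -> sigma y <> 4 -> P (2 * n) <-> P (sigma y).
  move=> w3 w4; apply: (E _ _ (tau (sigma y))); right; right; left.
  by exists (sigma y); split; rewrite ?sigmaK ?sigma_lt//; [right|right].
have Estep i : i.+1 < 2 * n -> i <> y -> i.+1 <> y ->
    odd i \/ ~~ removed_tile i y -> (P i <-> P i.+1).
  move=> iN xi xi1 ri; have [oi|oi] := boolP (odd i).
    have si : sigma i = i.+1 by have := @sigmaP i; lia.
    apply: (E _ _ (sigma y)); right; left; split; rewrite ?si//; first lia.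
    by move=> iE; apply: xi1; rewrite -si iE sigmaK.
  have ti : tau i = i.+1 by rewrite /tau (negbTE oi).
  apply: (E _ _ (tau y)); left; split; rewrite ?ti//; first lia.
    by move=> iE; apply: xi1; rewrite -ti iE tauK.
  by case: ri => //; rewrite (negbTE oi).
have hi a : 2 <= y -> y < a -> a < 2 * n -> P y.+1 <-> P a.
  move=> y2 xa an; apply: (@iff_chain y.+1 (2 * n)); last lia.
  by move=> i ix iN; apply: Estep; rewrite /removed_tile; lia.
have fin (all : forall a, a < 2 * n -> a <> y -> P (2 * n) <-> P a) : P x0 -> P x.
  have all' a : a <= 2 * n -> a <> y -> P (2 * n) <-> P a.
    by move=> an ay; have [->//|/eqP ?] := eqVneq a (2 * n); apply: all; lia.
  by move=> h; apply/(all' _ xn xy)/(all' _ x0n xy0).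
have sq12 : 2 < y -> P 1 <-> P 2 by move=> y2; apply: Estep; lia.
have [y25|y25] := boolP (2 <= y <= 5).
  apply: fin => a an ay; have [ya|ya] := ltnP y a.
    rewrite -(hi a)//; last lia.
    have : y = 2 \/ y = 3 \/ y = 4 \/ y = 5 by lia.
    case=> [?|[?|[?|?]]]; subst y.
    - have e1 := Esigma _ _; rewrite sigma2 in e1; rewrite e1//.
      by apply: (Enew _ _ 4); rewrite /added /pairs2; lia.
    - have e1 : P (2 * n) <-> P 2 by exact: Etau.
      have e2 : P 1 <-> P 4 by apply: (Enew _ _ 5); rewrite /added /pairs2; lia.
      by have := sq12 isT; tauto.
    - exact: Etau.
    - have s5 : sigma 5 = 6 by have := @sigmaP 5; lia.
      by rewrite s5 in Esigma; exact: Esigma.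
  have : y = 2 \/ y = 3 \/ y = 4 \/ y = 5 by lia.
  case=> [?|[?|[?|?]]]; subst y.
  - have e0 : P 0 <-> P (2 * n) by apply: (Enew _ _ 3); rewrite /added /pairs2; lia.
    have e1 := Esigma _ _; rewrite sigma2 in e1.
    have : a = 0 \/ a = 1 by lia.
    by case=> ->; [tauto|exact: e1].
  - have e0 : P 0 <-> P (2 * n) by apply: (Enew _ _ 2); rewrite /added /pairs2; lia.
    have e1 : P (2 * n) <-> P 2 by exact: Etau.
    have e2 := sq12 isT.
    have : a = 0 \/ a = 1 \/ a = 2 by lia.
    by case=> [->|[->|->]]; tauto.
  - have e0 : P 0 <-> P 3 by apply: (Enew _ _ 5); rewrite /added /pairs2; lia.
    have e1 : P 1 <-> P 3 by apply: (Enew _ _ 2); rewrite /added /pairs2; lia.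
    have e2 := sq12 isT.
    have e3 : P 2 <-> P (2 * n) by apply: (Enew _ _ 5); rewrite /added /pairs2; lia.
    have : a = 0 \/ a = 1 \/ a = 2 \/ a = 3 by lia.
    by case=> [->|[->|[->|->]]]; tauto.
  - have e0 : P 0 <-> P 3 by apply: (Enew _ _ 4); rewrite /added /pairs2; lia.
    have e1 : P 1 <-> P 4 by apply: (Enew _ _ 3); rewrite /added /pairs2; lia.
    have e2 := sq12 isT.
    have e3 : P 2 <-> P (2 * n) by apply: (Enew _ _ 4); rewrite /added /pairs2; lia.
    have e4 : P 3 <-> P 4 by apply: Estep; lia.
    have : a = 0 \/ a = 1 \/ a = 2 \/ a = 3 \/ a = 4 by lia.
    by case=> [->|[->|[->|[->|->]]]]; tauto.
have step i : i.+1 < 2 * n -> i <> y -> i.+1 <> y -> P i <-> P i.+1.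
  by move=> *; apply: Estep => //; right; rewrite /removed_tile; lia.
have et : P (2 * n) <-> P (tau y) by apply: Etau; rewrite /tau; case: ifP; lia.
have es : P (2 * n) <-> P (sigma y) by apply: Esigma; have := sigmaP yn; lia.
apply: fin => a an ay; have [ya|ya] := ltnP y a.
  have -> : P (2 * n) <-> P y.+1.
    have [oy|oy] := boolP (odd y); last by move: et; rewrite /tau (negbTE oy).
    by have <- : sigma y = y.+1 by have := sigmaP yn; lia.
  apply: (@iff_chain y.+1 (2 * n)); last lia.
  by move=> i ix iN; apply: step; lia.
have ch b : b < y -> P 0 <-> P b.
  by move=> bY; apply: (@iff_chain 0 y) => // i _ iy; apply: step; lia.
rewrite -(ch a); last lia.
rewrite (ch y.-1); last lia.
have [oy|oy] := boolP (odd y); first by move: et; rewrite /tau oy.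
by have <- : sigma y = y.-1 by have := sigmaP yn; lia.
Qed.

End Connection.
End Opposite.

Local Open Scope classical_set_scope.
Local Open Scope ring_scope.

(** * Continuity and homeomorphisms *)

Lemma within_comp (T U V : topologicalType) (A : set T) (B : set U)
    (f : T -> U) (g : U -> V) :
  {within A, continuous f} -> {within B, continuous g} -> f @` A `<=` B ->
  {within A, continuous (g \o f)}.
Proof.
move=> /subspace_continuousP cf /subspace_continuousP cg fAB.
apply/subspace_continuousP => x Ax.
have Bfx : B (f x) by apply: fAB; exists x.
move=> W /(cg _ Bfx) nW.
have := cf _ Ax _ nW; rewrite /nbhs /= /within /=.
by apply: filterS => t /= Wt At; apply: Wt => //; apply: fAB; exists t.
Qed.

Lemma homeomorphism_intro (T U : topologicalType) (A : set T) (B : set U)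
    (f : T -> U) (g : U -> T) :
  {within A, continuous f} -> {within B, continuous g} ->
  f @` A `<=` B -> g @` B `<=` A ->
  (forall x, A x -> g (f x) = x) -> (forall y, B y -> f (g y) = y) ->
  homeomorphism A B f.
Proof.
move=> cf cg fAB gBA gf fg; split=> //; last first.
  by exists g => // x /set_mem /gf.
split=> [x Ax|x y /set_mem Ax /set_mem Ay fxy|y By].
- by apply: fAB; exists x.
- by rewrite -(gf _ Ax) fxy gf.
- by exists (g y); [apply: gBA; exists y|exact: fg].
Qed.

Lemma homeomorphism_comp (T U V : topologicalType) (A : set T) (B : set U)
    (C : set V) (f : T -> U) (g : U -> V) :
  homeomorphism A B f -> homeomorphism B C g -> homeomorphism A C (g \o f).
Proof.
move=> [[fAB _ fsurj] cf [f' cf' f'f]] [[gBC _ gsurj] cg [g' cg' g'g]].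
have f'BA y : B y -> A (f' y).
  by move=> /fsurj[x Ax <-]; rewrite f'f ?inE.
have g'CB y : C y -> B (g' y).
  by move=> /gsurj[x Ax <-]; rewrite g'g ?inE.
apply: (@homeomorphism_intro _ _ _ _ _ (f' \o g')).
- by apply: (within_comp cf cg) => _ [x Ax <-]; exact: fAB.
- by apply: (within_comp cg' cf') => _ [x Ax <-]; exact: g'CB.
- by move=> _ [x Ax <-]; apply/gBC/fAB.
- by move=> _ [x Ax <-]; apply/f'BA/g'CB.
- by move=> x Ax /=; rewrite g'g ?inE ?f'f ?inE//; exact: fAB.
- move=> y /gsurj[x Bx <-] /=; rewrite g'g ?inE//.
  by have /fsurj[z Az <-] := Bx; rewrite f'f ?inE.
Qed.

Section RealFunctions.
Variables (R : realType) (T : topologicalType).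
Implicit Types f g : T -> R.

Lemma fcontD f g : continuous f -> continuous g -> continuous (fun x => f x + g x).
Proof. by move=> cf cg x; exact: (cvgD (cf x) (cg x)). Qed.

Lemma fcontN f : continuous f -> continuous (fun x => - f x).
Proof. by move=> cf x; exact: (cvgN (cf x)). Qed.

Lemma fcontB f g : continuous f -> continuous g -> continuous (fun x => f x - g x).
Proof. by move=> cf cg x; exact: (cvgB (cf x) (cg x)). Qed.

Lemma fcontM f g : continuous f -> continuous g -> continuous (fun x => f x * g x).
Proof. by move=> cf cg x; exact: (cvgM (cf x) (cg x)). Qed.

Lemma fcont_cst (c : R) : continuous (fun _ : T => c).
Proof. by move=> x; exact: cvg_cst. Qed.

Lemma fcont_max f g : continuous f -> continuous g ->
  continuous (fun x => Num.max (f x) (g x)).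
Proof. by move=> cf cg x; exact: (@continuous_max R T f g x (cf x) (cg x)). Qed.

Lemma fcont_min f g : continuous f -> continuous g ->
  continuous (fun x => Num.min (f x) (g x)).
Proof. by move=> cf cg x; exact: (@continuous_min R T f g x (cf x) (cg x)). Qed.

Lemma fcont_norm f : continuous f -> continuous (fun x => `|f x|).
Proof. by move=> cf x; exact: (cvg_norm (cf x)). Qed.

Lemma fcont_sum (I : Type) (s : seq I) (F : I -> T -> R) :
  (forall i, continuous (F i)) -> continuous (fun x => \sum_(i <- s) F i x).
Proof.
move=> cF; elim: s => [|i s IH].
  by under eq_fun do rewrite big_nil; exact: fcont_cst.
under eq_fun do rewrite big_cons; exact: fcontD.
Qed.

End RealFunctions.

Lemma fcont_fst (R : realType) : continuous (fun p : R * R => p.1).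
Proof. by move=> p; exact: cvg_fst. Qed.

Lemma fcont_snd (R : realType) : continuous (fun p : R * R => p.2).
Proof. by move=> p; exact: cvg_snd. Qed.

Section Plane.
Variable R : realType.
Implicit Types p q : R * R.

Lemma within_pair (T : topologicalType) (A : set T) (f g : T -> R) :
  {within A, continuous f} -> {within A, continuous g} ->
  {within A, continuous (fun t => (f t, g t))}.
Proof. by move=> cf cg x; exact: (cvg_pair (cf x) (cg x)). Qed.

Definition sqnorm p := p.1 * p.1 + p.2 * p.2.

Lemma sqnorm_ge0 p : 0 <= sqnorm p.
Proof. by rewrite addr_ge0 // -expr2 sqr_ge0. Qed.

Definition pscale (a : R) p := (a * p.1, a * p.2).

Lemma sqnorm_scale a p : sqnorm (pscale a p) = a ^+ 2 * sqnorm p.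
Proof. by rewrite /sqnorm /=; ring. Qed.

Lemma continuous_sqnorm : continuous sqnorm.
Proof.
have c1 : continuous (fun p : R * R => p.1) by move=> p; exact: cvg_fst.
have c2 : continuous (fun p : R * R => p.2) by move=> p; exact: cvg_snd.
by move=> p; exact: (cvgD (cvgM (c1 p) (c1 p)) (cvgM (c2 p) (c2 p))).
Qed.

Lemma continuous_pscale (T : topologicalType) (a : T -> R) (f : T -> R * R) :
  continuous a -> continuous f -> continuous (fun t => pscale (a t) (f t)).
Proof.
move=> ca cf.
have c1 : continuous (fun t => (f t).1).
  by move=> x; exact: (continuous_comp (cf x) (@cvg_fst _ _ _ _ _)).
have c2 : continuous (fun t => (f t).2).
  by move=> x; exact: (continuous_comp (cf x) (@cvg_snd _ _ _ _ _)).
by move=> x; exact: (cvg_pair (cvgM (ca x) (c1 x)) (cvgM (ca x) (c2 x))).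
Qed.

(** The inverse is the radial map with factor [1 / sqrt (1 + r)], where [r] is the squared norm:
    [1 + r / (1 - r) = 1 / (1 - r)] makes the two factors cancel. *)
Lemma unit_disk_plane :
  homeomorphism (@unit_disk R) setT (fun p => pscale (Num.sqrt (1 - sqnorm p))^-1 p).
Proof.
have d1 p : unit_disk p -> 0 < 1 - sqnorm p.
  by rewrite subr_gt0 /sqnorm -!expr2.
have d2 p : 0 < 1 + sqnorm p by rewrite ltr_pwDl // sqnorm_ge0.
apply: (@homeomorphism_intro _ _ _ _ _
  (fun p => pscale (Num.sqrt (1 + sqnorm p))^-1 p)).
- apply: (@continuous_pscale (subspace (@unit_disk R))); last first.
    by apply: continuous_subspaceT => ?; exact: cvg_id.
  apply/subspace_continuousP => x Ax.
  apply: cvgV; first by rewrite sqrtr_eq0 -ltNge d1.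
  apply: cvg_within_filter.
  apply: continuous_comp; last exact: sqrt_continuous.
  by apply: cvgB; [exact: cvg_cst|exact: continuous_sqnorm].
- apply: continuous_subspaceT.
  apply: continuous_pscale; last by move=> ?; exact: cvg_id.
  move=> x; apply: cvgV; first by rewrite sqrtr_eq0 -ltNge d2.
  apply: continuous_comp; last exact: sqrt_continuous.
  by apply: cvgD; [exact: cvg_cst|exact: continuous_sqnorm].
- by [].
- move=> _ [p _ <-]; rewrite /unit_disk /mkset !expr2 -[X in X < _]/(sqnorm _).
  rewrite sqnorm_scale exprVn sqr_sqrtr ?ltW// mulrC ltr_pdivrMr//.
  by rewrite mul1r ltrDr.
- move=> p /d1 dp; rewrite sqnorm_scale exprVn sqr_sqrtr ?ltW//.
  have -> : 1 + (1 - sqnorm p)^-1 * sqnorm p = (1 - sqnorm p)^-1.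
    by field; rewrite gt_eqF.
  rewrite sqrtrV ?ltW// invrK /pscale /= !mulrA mulfV ?mul1r -?surjective_pairing//.
  by rewrite sqrtr_eq0 -ltNge.
- move=> p _; have dp := d2 p; rewrite sqnorm_scale exprVn sqr_sqrtr ?ltW//.
  have -> : 1 - (1 + sqnorm p)^-1 * sqnorm p = (1 + sqnorm p)^-1.
    by field; rewrite gt_eqF.
  rewrite sqrtrV ?ltW// invrK /pscale /= !mulrA mulfV ?mul1r -?surjective_pairing//.
  by rewrite sqrtr_eq0 -ltNge.
Qed.

End Plane.

(** * Complete fans in the plane *)

Section Fan.
Variables (R : realType) (M : nat).
Hypothesis M_ge2 : (2 <= M)%N.

(* Rays through (0, 1), (1, 1), ..., (M, 1) and (-1, -1) span M + 2 cones that
   tile the plane; [hat k] is the piecewise linear function that is 1 on [ray k]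
   and 0 on the other rays. *)
Definition ray (k : nat) : R * R := if (k <= M)%N then (k%:R, 1) else (-1, -1).

Definition nxt (k : nat) : nat := if k == M.+1 then 0%N else k.+1.

Definition cone_pt k (s t : R) : R * R :=
  (s * (ray k).1 + t * (ray (nxt k)).1, s * (ray k).2 + t * (ray (nxt k)).2).

Definition hat (k : nat) (p : R * R) : R :=
  Num.max 0
  (if k == 0%N then p.2 - p.1
   else if (k < M)%N then Num.min (p.1 - (k%:R - 1) * p.2) ((k%:R + 1) * p.2 - p.1)
   else if k == M then
     Num.min (p.1 - (M%:R - 1) * p.2) ((M%:R - 1)^-1 * (p.1 - p.2))
   else Num.max (- p.1) ((M%:R - 1)^-1 * (p.1 - M%:R * p.2))).

(** [M_ge2] keeps the cone between [(M, 1)] and [(-1, -1)] narrower than a half-plane; for [M = 1]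
    these rays would be opposite and would span only a line. *)
Lemma cone_cover p : exists k s t, [/\ (k <= M.+1)%N, 0 <= s, 0 <= t & p = cone_pt k s t].
Proof.
have M2 : (2 : R) <= M%:R by rewrite (ler_nat R 2 M).
have i0 : 0 < (M%:R - 1 : R)^-1 by rewrite invr_gt0; lra.
case: p => a b.
have [a0|a0] := leP a 0.
  have [ab|ab] := leP a b.
    exists M.+1, (- a), (b - a); split; [by []|lra|lra|].
    by rewrite /cone_pt /nxt eqxx /ray ltnn /=; congr pair; lra.
  have h : a - M%:R * b >= 0 by nra.
  exists M, ((M%:R - 1)^-1 * (a - b)), ((M%:R - 1)^-1 * (a - M%:R * b)); split=> //.
  - by apply: mulr_ge0; lra.
  - by apply: mulr_ge0; lra.
  rewrite /cone_pt /nxt ltn_eqF// /ray leqnn ltnn /=.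
  by congr pair; field; lra.
have [ab|ab] := leP a (M%:R * b); last first.
  have h : a - b >= 0 by nra.
  exists M, ((M%:R - 1)^-1 * (a - b)), ((M%:R - 1)^-1 * (a - M%:R * b)); split=> //.
  - by apply: mulr_ge0; lra.
  - by apply: mulr_ge0; lra.
  rewrite /cone_pt /nxt ltn_eqF// /ray leqnn ltnn /=.
  by congr pair; field; lra.
(* Here [b] is positive and [k] is the integer part of [a / b], up to the choice at cone boundaries;
   induction on [M] finds it without dividing. *)
have [k [kM k1 k2]] : exists k : nat, [/\ (k < M)%N, k%:R * b <= a & a <= (k.+1)%:R * b].
  move: ab; elim: M M_ge2 => // m IH _ ab.
  have [h|h] := leP a (m%:R * b); last by exists m; split=> //; apply: ltW.
  have [m1|m1] := leqP 2 m.
    by have [k [? ? ?]] := IH m1 h; exists k; split=> //; apply: ltnW.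
  exists 0%N; rewrite mul0r mul1r; split=> //; first exact: ltW.
  have [m0|m0] : m = 0%N \/ m = 1%N by lia.
    by move: h; rewrite m0; lra.
  by move: h; rewrite m0 mul1r.
exists k, (k.+1%:R * b - a), (a - k%:R * b); split; rewrite ?subr_ge0//; first lia.
rewrite /cone_pt /nxt ltn_eqF; last lia.
rewrite /ray (ltnW kM) kM /= -natr1; congr pair; ring.
Qed.

(** The hats recover the coordinates of a point in its cone, whichever cone that is. Since each hat
    is one formula in maxima and minima of linear forms, continuity needs no gluing along the rays;
    the price is this comparison of every hat with every cone. *)
Lemma hat_cone j k (s t : R) : (j <= M.+1)%N -> (k <= M.+1)%N -> 0 <= s -> 0 <= t ->
  hat j (cone_pt k s t) = s *+ (j == k) + t *+ (j == nxt k).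
Proof.
have M2 : (2 : R) <= M%:R by rewrite (ler_nat R 2 M).
have i0 : 0 < (M%:R - 1 : R)^-1 by rewrite invr_gt0; lra.
move=> jL kL s0 t0; rewrite /hat /cone_pt /nxt.
have max0 (x : R) : x <= 0 -> Num.max 0 x = 0 by move=> ?; apply/max_idPl.
have maxr (x : R) : 0 <= x -> Num.max 0 x = x by move=> ?; apply/max_idPr.
have [kM|kM] := ltnP k M.
  rewrite (ltn_eqF (ltn_trans kM _))// /ray (ltnW kM) kM /=.
  rewrite -[k.+1%:R]natr1.
  have k0 : 0 <= k%:R :> R by [].
  have k1 : k%:R + 1 <= M%:R :> R by rewrite natr1 ler_nat.
  have [->|j0] := eqVneq j 0%N.
    have [->|kn0] := eqVneq k 0%N.
      by rewrite maxr /= ?mulr1n ?mulr0n; lra.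
    have : (1 : R) <= k%:R by rewrite ler1n lt0n.
    by move=> ?; rewrite max0 /= 1?eq_sym ?(negbTE kn0) ?addr0 //; nra.
  have j1 : (1 : R) <= j%:R by rewrite ler1n lt0n.
  have [jM|jM] := ltnP j M.
    have [jk|jk|->] := ltngtP j k.
    - have : j%:R + 1 <= k%:R :> R by rewrite natr1 ler_nat.
      move=> ?; rewrite (ltn_eqF (ltnW jk : (j < k.+1)%N)) max0 ?addr0//.
      by rewrite ge_min; apply/orP; right; nra.
    - have [->|jk1] := eqVneq j k.+1.
        rewrite mulr0n mulr1n add0r -[k.+1%:R]natr1 min_l; last by nra.
        by rewrite maxr; lra.
      have : k%:R + 1 + 1 <= j%:R :> R by rewrite !natr1 ler_nat; lia.
      move=> ?; rewrite max0 ?addr0//.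
      by rewrite ge_min; apply/orP; left; nra.
    - rewrite ltn_eqF// mulr0n mulr1n addr0 min_r; last by nra.
      by rewrite maxr; lra.
  have [jE|jE] := eqVneq j M.
    rewrite (gtn_eqF (_ : k < j)%N); last lia.
    have [kE|kE] := eqVneq j k.+1.
      have Mk : M%:R = k%:R + 1 :> R by rewrite natr1; congr _%:R; lia.
      have k01 : (1 : R) <= k%:R by lra.
      rewrite min_l Mk; last first.
        by rewrite addrK -(ler_pM2l (_ : 0 < k%:R)) ?mulVKf ?gt_eqF//; nra.
      by rewrite maxr ?mulr0n ?mulr1n; lra.
    have : k%:R + 1 + 1 <= M%:R :> R by rewrite !natr1 ler_nat; lia.
    move=> ?; rewrite max0 ?addr0//.
    by rewrite ge_min; apply/orP; left; nra.
  rewrite !gtn_eqF; try lia.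
  rewrite max0 ?addr0// ge_max; apply/andP; split; first by nra.
  by apply: mulr_ge0_le0; [exact: ltW|nra].
have [kE|kE] := eqVneq k M.+1.
  rewrite kE /ray ltnn /=.
  have [j0|j0] := eqVneq j 0%N.
    by rewrite j0 /= ?mulr0n ?mulr1n maxr; lra.
  have j1 : (1 : R) <= j%:R by rewrite ler1n lt0n.
  have [jM|jM] := ltnP j M.
    rewrite (ltn_eqF (ltnW jM : (j < M.+1)%N)) max0 ?addr0//.
    rewrite ge_min; set u := _ - _; set v := _ - _.
    (* A combination of [u] and [v] with weights positive and nonnegative is at most 0, so [u] and
       [v] are not both positive. *)
    have uv : (j%:R + 1) * u + (j%:R - 1) * v = - s - s by rewrite /u /v; ring.
    have [//|u0] := leP u 0; have [//|v0] := leP v 0.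
    by exfalso; have : 0 <= (j%:R - 1) * v by [apply: mulr_ge0; lra]; nra.
  have [jE|jE] := eqVneq j M.
    rewrite ltn_eqF ?jE // mulr0n addr0 max0// ge_min; apply/orP; right.
    by apply: mulr_ge0_le0; [exact: ltW|lra].
  have -> : j = M.+1 by lia.
  rewrite eqxx mulr1n mulr0n addr0 [Num.max (- _) _]max_l.
    by rewrite maxr; lra.
  have m0 : 0 < M%:R - 1 :> R by lra.
  by rewrite -(ler_pM2l m0) mulVKf ?gt_eqF//; nra.
have -> : k = M by lia.
rewrite /ray leqnn ltnn /=.
have [j0|j0] := eqVneq j 0%N.
  by rewrite j0 (ltn_eqF (_ : 0 < M)%N) ?addr0 ?max0 //; [nra|lia].
have j1 : (1 : R) <= j%:R by rewrite ler1n lt0n.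
have [jM|jM] := ltnP j M.
  have ? : j%:R + 1 <= M%:R :> R by rewrite natr1 ler_nat.
  rewrite !ltn_eqF ?addr0 ?max0 //; last lia.
  by rewrite ge_min; apply/orP; right; nra.
have E1 : (M%:R - 1)^-1 * (s * M%:R + t * -1 - (s * 1 + t * -1)) = s.
  by field; lra.
have E2 : (M%:R - 1)^-1 * (s * M%:R + t * -1 - M%:R * (s * 1 + t * -1)) = t.
  by field; lra.
have [jE|jE] := eqVneq j M.
  rewrite jE ltn_eqF// mulr0n mulr1n addr0 E1 min_r; last by nra.
  by rewrite maxr.
have -> : j = M.+1 by lia.
rewrite eqxx E2 [Num.max (- _) _]max_r; last by nra.
by rewrite maxr// mulr1n mulr0n add0r.
Qed.

Lemma hat_ge0 k p : 0 <= hat k p.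
Proof. by rewrite le_max lexx. Qed.

Lemma continuous_hat k : continuous (hat k).
Proof.
have c1 := @fcont_fst R; have c2 := @fcont_snd R.
apply: fcont_max; first exact: fcont_cst.
case: (k == 0%N); first exact: fcontB.
case: (k < M)%N.
  apply: fcont_min; apply: fcontB => //; apply: fcontM => //; exact: fcont_cst.
case: (k == M).
  apply: fcont_min.
    by apply: fcontB => //; apply: fcontM => //; exact: fcont_cst.
  by apply: fcontM; [exact: fcont_cst|exact: fcontB].
apply: fcont_max; first exact: fcontN.
apply: fcontM; first exact: fcont_cst.
by apply: fcontB => //; apply: fcontM => //; exact: fcont_cst.
Qed.

End Fan.

(** * Polyhedra of two-dimensional complexes *)

Section Polyhedron.
Variables (R : realType) (X : finType) (tri : X -> X -> X -> bool).
Implicit Types (u v w z : X) (x : X -> R).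

Definition in_tri x u v w :=
  [/\ forall z, 0 <= x z, forall z, z \notin [:: u; v; w] -> x z = 0
    & x u + x v + x w = 1].

Definition polyhedron : set {ptws X -> R} :=
  [set x | exists u v w, tri u v w /\ in_tri x u v w].

Definition space := set_type polyhedron.

Definition crd (p : space) : X -> R := set_val p.

Lemma crd_polyhedron p : polyhedron (crd p).
Proof. exact: set_valP. Qed.

Lemma crd_inj : injective crd.
Proof. by move=> p q pq; apply: val_inj. Qed.

(** Functions outside the polyhedron are sent to the default point [p0]; this makes maps into the
    subtype total, and [mkK] gives the value where it matters. *)
Definition mk (p0 : space) (x : X -> R) : space :=
  insubd p0 (x : {ptws X -> R}).

Lemma mkK p0 x : polyhedron x -> crd (mk p0 x) = x.
Proof. by move=> Kx; rewrite /crd /mk -[RHS](@insubdK _ _ _ p0 x)// inE. Qed.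

Lemma continuous_crd z : continuous (fun p : space => crd p z).
Proof.
move=> t.
apply: (@continuous_comp space {ptws X -> R} R set_val (fun f => f z)).
  exact: initial_continuous.
exact: proj_continuous.
Qed.

Lemma continuous_space (T : topologicalType) (g : T -> space) :
  (forall z, continuous (fun t => crd (g t) z)) -> continuous g.
Proof.
move=> cg.
have cg' : continuous (fun t => set_val (g t) : {ptws X -> R}).
  move=> t; apply/cvg_sup => i.
  exact: (@continuous_comp_initial {ptws X -> R} T R (fun f => f i) _ (cg i) t).
exact: (@continuous_comp_initial space T _ set_val g cg').
Qed.

Lemma within_mk (T : topologicalType) (A : set T) p0 (g : T -> X -> R) :
  (forall z, {within A, continuous (fun t => g t z)}) ->
  (forall t, A t -> polyhedron (g t)) ->
  {within A, continuous (fun t => mk p0 (g t))}.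
Proof.
move=> cg Kg; apply: (@continuous_space (subspace A)) => z.
apply: subspace_eq_continuous (cg z) => t /set_mem At.
by rewrite /from_subspace mkK//; exact: Kg.
Qed.

Lemma space_hausdorff : hausdorff_space space.
Proof.
move=> p q pq; apply: crd_inj; apply/funext => z.
apply: (@Rhausdorff R) => A B nA nB.
have [r [Ar Br]] := pq _ _ (@continuous_crd z p A nA) (@continuous_crd z q B nB).
by exists (crd r z).
Qed.

Definition star v : set space := [set p | 0 < crd p v].

Lemma open_star v : open (star v).
Proof.
apply: (@open_comp _ _ (fun p => crd p v) [set y | 0 < y]).
  by move=> p _; exact: continuous_crd.
exact: open_gt.
Qed.

Hypothesis tri_swap12 : forall u v w, tri u v w -> tri v u w.
Hypothesis tri_swap23 : forall u v w, tri u v w -> tri u w v.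
Hypothesis tri_neq12 : forall u v w, tri u v w -> u != v.

Lemma tri_neq13 u v w : tri u v w -> u != w.
Proof. by move=> /tri_swap23/tri_neq12. Qed.

Lemma tri_neq23 u v w : tri u v w -> v != w.
Proof. by move=> /tri_swap12/tri_neq13. Qed.

Lemma in_tri_swap12 x u v w : in_tri x u v w -> in_tri x v u w.
Proof.
move=> [h1 h2 h3]; split=> [//|z zn|]; last by rewrite [x v + _]addrC.
by apply: h2; apply: contra zn; rewrite !inE orbCA.
Qed.

Lemma in_tri_swap23 x u v w : in_tri x u v w -> in_tri x u w v.
Proof.
move=> [h1 h2 h3]; split=> [//|z zn|]; last by rewrite addrAC.
by apply: h2; apply: contra zn; rewrite !inE [(z == v) || _]orbC.
Qed.

Lemma star_tri v p : star v p -> exists a b, tri v a b /\ in_tri (crd p) v a b.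
Proof.
move=> vp; have [a [b [c [abc pabc]]]] := crd_polyhedron p.
have : v \in [:: a; b; c].
  by have [_ h _] := pabc; apply: contraLR vp => /h; rewrite /star /= => ->; rewrite ltxx.
rewrite !inE => /or3P[]/eqP vE; subst v.
- by exists b, c.
- by exists a, c; split; [exact: tri_swap12|exact: in_tri_swap12].
- exists a, b; split; first by apply/tri_swap12/tri_swap23.
  by apply/in_tri_swap12/in_tri_swap23.
Qed.

(** * Open stars over cyclic links *)

Section Link.
Variables (v : X) (M : nat) (s : seq X) (p0 : space).
Hypotheses (M_ge2 : (2 <= M)%N) (s_size : size s = M.+2) (s_uniq : uniq s).
Hypothesis v_notin : v \notin s.
Local Notation sn := (nth v s).
Hypothesis linkP : forall a b, tri v a b <->
  exists2 k, (k <= M.+1)%N &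
    (a = sn k /\ b = sn (nxt M k)) \/ (b = sn k /\ a = sn (nxt M k)).

Lemma nxt_le k : (k <= M.+1)%N -> (nxt M k <= M.+1)%N.
Proof. by rewrite /nxt; case: eqP => [|/eqP] h; lia. Qed.

Lemma nxt_neq k : (k <= M.+1)%N -> (nxt M k == k) = false.
Proof. by move=> _; rewrite /nxt; case: (k =P M.+1) => [->//|_]; rewrite gtn_eqF. Qed.

Lemma sum_two (k l : nat) (c : nat -> R) (a b : R) : (k <= M.+1)%N -> (l <= M.+1)%N ->
  \sum_(i < M.+2) (a *+ (i == k :> nat) + b *+ (i == l :> nat)) * c i = a * c k + b * c l.
Proof.
move=> kM lM; under eq_bigr do rewrite mulrDl; rewrite big_split /=; congr (_ + _).
  rewrite (bigD1 (Ordinal (kM : (k < M.+2)%N)))//= eqxx big1 ?addr0// => i.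
  by rewrite -val_eqE /= => /negbTE ->; rewrite mulr0n mul0r.
rewrite (bigD1 (Ordinal (lM : (l < M.+2)%N)))//= eqxx big1 ?addr0// => i.
by rewrite -val_eqE /= => /negbTE ->; rewrite mulr0n mul0r.
Qed.

(* Dividing by the coordinate at v turns the open star of v into the cone over
   its link, which the rays send onto the plane. *)
Definition to_plane (p : space) : R * R :=
  (\sum_(i < M.+2) (crd p (sn i) / crd p v) * (ray R M i).1,
   \sum_(i < M.+2) (crd p (sn i) / crd p v) * (ray R M i).2).

(** Undoes the division by the coordinate at [v]: the hats of [q] are the quotients of the
    coordinates, and since the coordinates add up to 1, the one at [v] is the inverse of
    [mass q]. *)
Definition mass (q : R * R) := 1 + \sum_(i < M.+2) hat M i q.

Definition of_plane_crd (q : R * R) (z : X) : R :=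
  if z == v then (mass q)^-1
  else if z \in s then hat M (index z s) q / mass q else 0.

Lemma mass_gt0 q : 0 < mass q.
Proof. by rewrite ltr_pwDl// sumr_ge0// => i _; exact: hat_ge0. Qed.

Lemma mass_cone k a b : (k <= M.+1)%N -> 0 <= a -> 0 <= b ->
  mass (cone_pt M k a b) = 1 + (a + b).
Proof.
move=> kM a0 b0; rewrite /mass; congr (_ + _).
transitivity (\sum_(i < M.+2) (a *+ (i == k :> nat) + b *+ (i == nxt M k :> nat)) * 1).
  by apply: eq_bigr => i _; rewrite mulr1 hat_cone// -ltnS.
by rewrite (sum_two (fun=> 1))// ?nxt_le// !mulr1.
Qed.

Lemma of_plane_crd_v q : of_plane_crd q v = (mass q)^-1.
Proof. by rewrite /of_plane_crd eqxx. Qed.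

Lemma of_plane_crd_s q i : (i <= M.+1)%N -> of_plane_crd q (sn i) = hat M i q / mass q.
Proof.
move=> iM; have iS : (i < size s)%N by rewrite s_size.
rewrite /of_plane_crd (mem_nth _ iS) index_uniq//.
by case: eqP => // /(congr1 (mem s)); rewrite /= mem_nth// (negbTE v_notin).
Qed.

Lemma of_plane_polyhedron q : polyhedron (of_plane_crd q).
Proof.
have [k [a [b [kM a0 b0 qE]]]] := cone_cover M_ge2 q.
have m0 := mass_gt0 q.
have hE i : (i <= M.+1)%N -> hat M i q = a *+ (i == k) + b *+ (i == nxt M k).
  by move=> iM; rewrite qE hat_cone.
exists v, (sn k), (sn (nxt M k)); split; first by apply/linkP; exists k => //; left.
split.
- move=> z; rewrite /of_plane_crd; case: ifP => _; first by rewrite invr_ge0 ltW.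
  by case: ifP => // _; rewrite divr_ge0 ?hat_ge0 ?ltW.
- move=> z; rewrite !inE !negb_or => /and3P[zv zk zk1].
  rewrite /of_plane_crd (negbTE zv); case: ifPn => // zs.
  have iS : (index z s <= M.+1)%N by rewrite -ltnS -s_size index_mem.
  rewrite hE//.
  case: eqP => [ik|_]; first by rewrite -ik nth_index ?eqxx in zk.
  case: eqP => [ik|_]; first by rewrite -ik nth_index ?eqxx in zk1.
  by rewrite !mulr0n addr0 mul0r.
- have mE : mass q = 1 + (a + b) by rewrite qE mass_cone.
  rewrite of_plane_crd_v !of_plane_crd_s ?nxt_le// !hE ?nxt_le// !eqxx.
  rewrite nxt_neq// eq_sym nxt_neq// !mulr1n !mulr0n addr0 add0r.
  by rewrite mE; field; rewrite -mE gt_eqF.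
Qed.

Definition of_plane q : space := mk p0 (of_plane_crd q).

Lemma crd_of_plane q : crd (of_plane q) = of_plane_crd q.
Proof. by rewrite mkK//; exact: of_plane_polyhedron. Qed.

Lemma star_plane : homeomorphism setT (star v) of_plane.
Proof.
have cT : continuous mass.
  apply: fcontD; first exact: fcont_cst.
  by apply: fcont_sum => i; exact: continuous_hat.
have cV (T : topologicalType) (f : T -> R) : continuous f -> (forall t, f t != 0) ->
    continuous (fun t => (f t)^-1).
  by move=> cf f0 t; apply: cvgV; [exact: f0|exact: cf].
apply: (@homeomorphism_intro _ _ _ _ _ to_plane).
- apply: continuous_subspaceT; apply: continuous_space => z.
  rewrite (_ : (fun t => crd (of_plane t) z) = of_plane_crd^~ z); last first.
    by apply/funext => q; rewrite crd_of_plane.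
  have cI : continuous (fun q => (mass q)^-1).
    by apply: cV => // q; rewrite gt_eqF// mass_gt0.
  rewrite /of_plane_crd; case: (z == v) => //.
  case: (z \in s); last exact: fcont_cst.
  by apply: fcontM => //; exact: continuous_hat.
- have cI : {within star v, continuous (fun p => (crd p v)^-1)}.
    apply/subspace_continuousP => p vp; apply: cvgV; first by rewrite gt_eqF.
    by apply: cvg_within_filter; exact: continuous_crd.
  have cc z : {within star v, continuous (fun p => crd p z)}.
    by apply: continuous_subspaceT; exact: continuous_crd.
  apply: within_pair; apply: (@fcont_sum _ (subspace (star v))) => i;
    apply: (@fcontM _ (subspace (star v))); do ?[exact: fcont_cst];
    exact: (@fcontM _ (subspace (star v)) _ _ (cc _) cI).
- move=> _ [q _ <-]; rewrite /star /= crd_of_plane of_plane_crd_v.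
  by rewrite invr_gt0 mass_gt0.
- by [].
- move=> q _; have m0 : mass q != 0 by rewrite gt_eqF// mass_gt0.
  have [k [a [b [kM a0 b0 qE]]]] := cone_cover M_ge2 q.
  have E i : (i < M.+2)%N -> crd (of_plane q) (sn i) / crd (of_plane q) v =
      a *+ (i == k) + b *+ (i == nxt M k).
    move=> iM; rewrite crd_of_plane of_plane_crd_v of_plane_crd_s// invrK divfK//.
    by rewrite {1}qE hat_cone.
  rewrite /to_plane; under eq_bigr => i _ do rewrite E//.
  under [X in (_, X)]eq_bigr => i _ do rewrite E//.
  rewrite (sum_two (fun i => (ray R M i).1)) ?nxt_le//.
  by rewrite (sum_two (fun i => (ray R M i).2)) ?nxt_le// qE.
- move=> p vp; have [a [b [vab pvab]]] := star_tri vp.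
  wlog [k kM [aE bE]] : a b vab pvab / exists2 k, (k <= M.+1)%N & a = sn k /\ b = sn (nxt M k).
    move=> G; have /linkP[k kM [[aE bE]|[bE aE]]] := vab.
      by apply: (G a b) => //; exists k.
    apply: (G b a); [exact: tri_swap23|exact: in_tri_swap23|by exists k].
  have [x0 xout xsum] := pvab.
  have yv : 0 < crd p v by [].
  have yv0 : crd p v != 0 by rewrite gt_eqF.
  have s_inj i j : (i <= M.+1)%N -> (j <= M.+1)%N -> (sn i == sn j) = (i == j).
    by move=> iM jM; rewrite nth_uniq// s_size.
  have yE i : (i <= M.+1)%N -> crd p (sn i) = crd p a *+ (i == k) + crd p b *+ (i == nxt M k).
    move=> iM; have [ik|ik] := eqVneq i k.
      by rewrite ik aE eq_sym nxt_neq// mulr0n addr0.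
    have [ik1|ik1] := eqVneq i (nxt M k); first by rewrite ik1 bE mulr0n add0r.
    rewrite !mulr0n addr0 xout// !inE !negb_or aE bE !s_inj ?nxt_le// ik ik1 !andbT.
    by apply: contra v_notin => /eqP <-; rewrite mem_nth// s_size.
  have qE : to_plane p = cone_pt M k (crd p a / crd p v) (crd p b / crd p v).
    have E (i : 'I_M.+2) : crd p (sn i) / crd p v =
        (crd p a / crd p v) *+ (i == k :> nat) + (crd p b / crd p v) *+ (i == nxt M k :> nat).
      have iM : (i <= M.+1)%N by rewrite -ltnS.
      by rewrite (yE _ iM) mulrDl !mulrnAl.
    rewrite /to_plane; under eq_bigr do rewrite E.
    under [X in (_, X)]eq_bigr do rewrite E.
    rewrite (sum_two (fun i => (ray R M i).1)) ?nxt_le//.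
    by rewrite (sum_two (fun i => (ray R M i).2)) ?nxt_le.
  have a0 : 0 <= crd p a / crd p v by rewrite divr_ge0// ltW.
  have b0 : 0 <= crd p b / crd p v by rewrite divr_ge0// ltW.
  (* The coordinates at [v], [a] and [b] add up to 1; dividing by the one at [v] gives the claim. *)
  have mE : mass (to_plane p) = (crd p v)^-1.
    rewrite qE mass_cone//; apply: (mulIf yv0).
    by rewrite mulVf// !mulrDl !mul1r !divfK// addrA.
  apply: crd_inj; apply/funext => z; rewrite crd_of_plane.
  rewrite /of_plane_crd mE invrK; case: eqP => [->//|/eqP zv].
  case: ifPn => zs; last first.
    rewrite xout// !inE !negb_or zv /= aE bE.
    by apply/andP; split; apply: contraNN zs => /eqP ->; rewrite mem_nth// s_size// ltnS nxt_le.
  have iS : (index z s <= M.+1)%N by rewrite -ltnS -s_size index_mem.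
  rewrite qE hat_cone// -{3}(nth_index v zs) yE// mulrDl !mulrnAl; congr (_ *+ _ + _ *+ _);
    by rewrite divfK.
Qed.

Lemma star_disk : open_disk R (star v).
Proof.
exists (of_plane \o (fun p => pscale (Num.sqrt (1 - sqnorm p))^-1 p)).
exact: homeomorphism_comp (unit_disk_plane R) star_plane.
Qed.

End Link.

End Polyhedron.

(** * Connected two-regular graphs are cycles *)

Section TwoRegular.
Variables (X : finType) (e : rel X).
Hypothesis e_sym : symmetric e.
Hypothesis e_irr : irreflexive e.
Hypothesis e_deg2 : forall a b, e a b ->
  exists c, [/\ c != b, e a c & forall d, e a d -> d = b \/ d = c].

(* A path that cannot be prolonged at its end closes up at its start: the other
   neighbour of the end lies on the path, and an interior vertex of the path has
   no neighbour left. *)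
Lemma two_regular_path x0 s : uniq s -> (1 < size s)%N ->
    (forall i, (i.+1 < size s)%N -> e (nth x0 s i) (nth x0 s i.+1)) ->
  exists s', [/\ uniq s', (2 < size s')%N,
    forall i, (i.+1 < size s')%N -> e (nth x0 s' i) (nth x0 s' i.+1)
    & e (nth x0 s' (size s').-1) (nth x0 s' 0)].
Proof.
have [n] := ubnP (#|X| - size s); elim: n s => // n IH s sn us s1 es.
set l := (size s).-1.
have sl : size s = l.+1 by rewrite /l; lia.
have l0 : (0 < l)%N by lia.
have el : e (nth x0 s l) (nth x0 s l.-1).
  by rewrite e_sym; have := es l.-1; rewrite prednK// sl; apply.
have [c [cn ec cE]] := e_deg2 el.
have [cs|cs] := boolP (c \in s); last first.
  have ss : (size s < #|X|)%N.
    rewrite -[size s]/(size (c :: s)).-1 -(card_uniqP (_ : uniq (c :: s))) /= ?cs//.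
    have := max_card (mem (c :: s)).
    by rewrite (card_uniqP (_ : uniq (c :: s))) /= ?cs//; lia.
  apply: (IH (rcons s c)).
  - by rewrite size_rcons; lia.
  - by rewrite rcons_uniq cs.
  - by rewrite size_rcons; lia.
  move=> i; rewrite size_rcons ltnS => iS; rewrite !nth_rcons iS.
  have [h|h|h] := ltngtP i.+1 (size s); [exact: es|lia|].
  by have -> : i = l by lia.
pose j := index c s; have jS : (j < size s)%N by rewrite index_mem.
have cj : c = nth x0 s j by rewrite nth_index.
have jl : j != l by apply: contraTneq ec => jl; rewrite cj jl e_irr.
have jl1 : j != l.-1 by apply: contra cn => /eqP jl1; rewrite cj jl1.
have [j0|j0] := posnP j.
  exists s; split=> //; first by rewrite sl; lia.
  by rewrite -/l -j0 -cj.
have ej1 : e c (nth x0 s j.-1).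
  by rewrite cj e_sym; have := es j.-1; rewrite prednK//; apply.
have ej2 : e c (nth x0 s j.+1) by rewrite cj; apply: es; lia.
have [d [dn ed dE]] := e_deg2 ej1.
have ecl : e c (nth x0 s l) by rewrite e_sym.
have nE i k : (i < size s)%N -> (k < size s)%N -> nth x0 s i = nth x0 s k -> i = k.
  by move=> iS kS /eqP; rewrite nth_uniq// => /eqP.
have jl' : (j < l)%N by rewrite sl ltnS leq_eqVlt (negbTE jl) in jS.
have jS1 : (j.+1 < size s)%N by rewrite sl.
have lS : (l < size s)%N by rewrite sl.
have pS : (j.-1 < size s)%N by apply: leq_ltn_trans jS; exact: leq_pred.
have [/(nE _ _ lS pS) h|dl] := dE _ ecl; first by move: jl'; rewrite h ltnNge leq_pred.
have [/(nE _ _ jS1 pS) h|dj] := dE _ ej2.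
  by have := leq_pred j; rewrite -h ltnn.
have h : l = j.+1 by apply: nE => //; rewrite dl dj.
by rewrite h eqxx in jl1.
Qed.

(** The cycle found by [two_regular_path] already contains both neighbours of each of its vertices,
    so it is closed under [e] and connectedness makes it everything. Only vertices incident to an
    edge count, since a link occupies a small part of the vertex set [X]; [x0] is merely the default
    of [nth]. *)
Lemma two_regular_cycle x0 y0 y1 : e y0 y1 ->
  (forall a b, e a b -> connect e y0 a) ->
  exists s, [/\ uniq s, (2 < size s)%N &
    forall a b, e a b <-> exists2 k, (k < size s)%N &
      let k' := if k == (size s).-1 then 0%N else k.+1 in
      (a = nth x0 s k /\ b = nth x0 s k') \/ (b = nth x0 s k /\ a = nth x0 s k')].
Proof.
move=> e01 conn.
have [|||s [us s2 es el]] := @two_regular_path x0 [:: y0; y1].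
- by rewrite /= inE andbT; apply: contraTneq e01 => <-; rewrite e_irr.
- by [].
- by case=> [|[]].
exists s; split=> //.
set l := (size s).-1 in el *.
have sl : size s = l.+1 by rewrite /l; lia.
pose k' k := if k == l then 0%N else k.+1.
have ek k : (k < size s)%N -> e (nth x0 s k) (nth x0 s (k' k)).
  rewrite /k'; case: eqP => [->//|kl] kS; apply: es; lia.
have nb k b : (k < size s)%N -> e (nth x0 s k) b ->
    b = nth x0 s (k' k) \/ exists2 i, (i < size s)%N & k = k' i /\ b = nth x0 s i.
  move=> kS ekb; have [c [cn ec cE]] := e_deg2 (ek _ kS).
  have [i iS ki] : exists2 i, (i < size s)%N & k = k' i.
    case: (posnP k) => k0; first by exists l; rewrite ?sl // /k' eqxx.
    exists k.-1; first lia.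
    by rewrite /k'; case: eqP => [|_]; lia.
  have ekl : e (nth x0 s k) (nth x0 s i) by rewrite ki e_sym ek.
  (* Having more than two vertices keeps predecessor and successor apart, so they are the two
     neighbours. *)
  have nik : nth x0 s i <> nth x0 s (k' k).
    move=> /eqP; rewrite nth_uniq//.
      by move/eqP => h; move: h ki; rewrite /k'; case: eqP; case: eqP; lia.
    by rewrite /k'; case: eqP; lia.
  have ic : nth x0 s i = c by have [//|] := cE _ ekl.
  by have [->|->] := cE _ ekb; [left|right; exists i; rewrite ?ic].
have k'S k : (k < size s)%N -> (k' k < size s)%N by rewrite /k'; case: eqP; lia.
have clos a b : a \in s -> e a b -> b \in s.
  move=> /(nthP x0)[k kS <-] /nb[//|->|[i iS [_ ->]]]; rewrite mem_nth//.
  exact: k'S.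
have all_s a : connect e (nth x0 s 0) a -> a \in s.
  move=> /connectP[p]; have : nth x0 s 0 \in s by rewrite mem_nth// sl.
  elim: p (nth x0 s 0) => [|y p IH] z zs /=; first by move=> _ ->.
  by move=> /andP[zy yp] aE; apply: (IH y) => //; exact: clos zs zy.
have csym := sym_connect_sym e_sym.
have cov a b : e a b -> a \in s.
  move=> ab; apply: all_s; rewrite csym.
  apply: (connect_trans (y := y0)); first by rewrite csym; apply: conn ab.
  by apply: (conn _ _ (ek 0%N _)); rewrite sl.
move=> a b; split=> [ab|[k kS [[-> ->]|[-> ->]]]]; last 2 first.
- exact: ek.
- by rewrite e_sym; exact: ek.
have /(nthP x0)[k kS ka] := cov _ _ ab.
rewrite -ka in ab; have [bE|[i iS [ki bE]]] := nb _ _ kS ab.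
  by exists k => //; left; rewrite ka.
by exists i => //; right; rewrite -ka {1}ki.
Qed.

End TwoRegular.

(** * Segments and vertices in the polyhedron *)

Section Segments.
Variables (R : realType) (X : finType) (tri : X -> X -> X -> bool).
Hypothesis tri_swap12 : forall u v w, tri u v w -> tri v u w.
Hypothesis tri_swap23 : forall u v w, tri u v w -> tri u w v.
Hypothesis tri_neq12 : forall u v w, tri u v w -> u != v.
Local Notation polyhedron := (@polyhedron R X tri).
Local Notation space := (@space R X tri).
Variable p0 : space.

Definition seg (a b : X) (t : R) : X -> R :=
  fun z => (1 - t) *+ (z == a) + t *+ (z == b).

Lemma seg0 a b : seg a b 0 = seg a a 0.
Proof. by apply/funext => z; rewrite /seg !mul0rn. Qed.

Lemma seg1 a b : seg a b 1 = seg b b 0.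
Proof. by apply/funext => z; rewrite /seg subrr subr0 !mul0rn add0r addr0. Qed.

Lemma seg_rev a b t : seg b a t = seg a b (1 - t).
Proof. by apply/funext => z; rewrite /seg subKr addrC. Qed.

Lemma seg_out a b t z : z != a -> z != b -> seg a b t z = 0.
Proof. by rewrite /seg => /negbTE -> /negbTE ->; rewrite !mulr0n addr0. Qed.

Lemma seg_l a b t : a != b -> seg a b t a = 1 - t.
Proof. by rewrite /seg eqxx => /negbTE ->; rewrite mulr0n addr0. Qed.

Lemma seg_r a b t : a != b -> seg a b t b = t.
Proof. by rewrite /seg eqxx eq_sym => /negbTE ->; rewrite mulr0n add0r. Qed.

Lemma in_tri_seg a b c t : tri a b c -> 0 <= t <= 1 -> in_tri (seg a b t) a b c.
Proof.
move=> abc /andP[t0 t1]; have ab := tri_neq12 abc; split.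
- by move=> z; rewrite addr_ge0// mulrn_wge0// subr_ge0.
- by move=> z; rewrite !inE !negb_or => /and3P[za zb _]; rewrite seg_out.
rewrite seg_l// seg_r// seg_out; first by rewrite subrK addr0.
  by rewrite eq_sym; exact: (tri_neq13 tri_swap23 tri_neq12 abc).
by rewrite eq_sym; exact: (tri_neq23 tri_swap12 tri_swap23 tri_neq12 abc).
Qed.

Lemma polyhedron_seg a b c t : tri a b c -> 0 <= t <= 1 -> polyhedron (seg a b t).
Proof. by move=> abc t01; exists a, b, c; split=> //; exact: in_tri_seg. Qed.

(** A vertex is a degenerate segment, which lets [seg0] and [seg1] identify the ends of the arcs. *)
Definition vtx a : space := mk p0 (seg a a 0).

Lemma crd_vtx a b c : tri a b c -> crd (vtx a) = seg a a 0.
Proof.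
by move=> abc; rewrite mkK// -(seg0 a b); apply: (polyhedron_seg abc); rewrite lexx ler01.
Qed.

(** The set is the straight segment from [p] to the corner [u]. The coordinate at [u] does not
    decrease along it, so it stays in the open star of [u] when [p] lies there; this serves both for
    faces and for the whole space. *)
Lemma cone_connected (p : space) u v w : tri u v w -> in_tri (crd p) u v w ->
  exists A, [/\ connected A, A p, A (vtx u) & forall q, A q -> crd p u <= crd q u].
Proof.
move=> uvw [p_ge0 p_out p_sum].
pose c t : X -> R := fun z => (1 - t) * crd p z + t *+ (z == u).
have vu : (v == u) = false by rewrite eq_sym (negbTE (tri_neq12 uvw)).
have wu : (w == u) = false.
  by rewrite eq_sym (negbTE (tri_neq13 tri_swap23 tri_neq12 uvw)).
have Kc t : `[0, 1]%classic t -> polyhedron (c t).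
  rewrite /= in_itv /= => /andP[t0 t1]; exists u, v, w; split=> //; split.
  - by move=> z; rewrite addr_ge0 ?mulrn_wge0// mulr_ge0 ?subr_ge0.
  - move=> z zn; rewrite /c p_out// mulr0 add0r.
    by move: zn; rewrite inE negb_or => /andP[/negbTE -> _].
  - rewrite /c eqxx vu wu !mulr0n mulr1n !addr0.
    transitivity ((1 - t) * (crd p u + crd p v + crd p w) + t); first by ring.
    by rewrite p_sum mulr1 subrK.
have c0 : mk p0 (c 0) = p.
  apply: crd_inj; rewrite mkK; last by apply: Kc; rewrite /= in_itv /= lexx ler01.
  by apply/funext => z; rewrite /c subr0 mul1r mul0rn addr0.
have c1 : mk p0 (c 1) = vtx u.
  congr mk; apply/funext => z.
  by rewrite /c /seg subrr mul0r add0r subr0 mul0rn addr0.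
exists ((fun t => mk p0 (c t)) @` `[0, 1]%classic); split.
- apply: connected_continuous_connected; first exact: segment_connected.
  apply: within_mk => // z; apply: continuous_subspaceT => t.
  have cid : continuous (fun x : R => x) by move=> ?; exact: cvg_id.
  move: t; apply: fcontD.
    by apply: fcontM; [apply: fcontB => //; exact: fcont_cst|exact: fcont_cst].
  by case: (z == u); [exact: cid|exact: fcont_cst].
- by exists 0 => //=; rewrite in_itv /= lexx ler01.
- by exists 1 => //=; rewrite in_itv /= lexx ler01.
- move=> _ [t t01 <-]; rewrite mkK; last exact: Kc.
  move: t01; rewrite /= in_itv /= => /andP[t0 t1].
  have pu : crd p u <= 1.
    by rewrite -p_sum -addrA lerDl addr_ge0.
  by rewrite /c eqxx mulr1n; nra.
Qed.

End Segments.

(** * Surfaces of quadrilaterals *)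

Section SquareCoordinates.
Variable R : realType.
Implicit Types q : R * R.

(* Barycentric coordinates in the unit square subdivided by its diagonals:
   [sq0], ..., [sq3] belong to (0,0), (1,0), (1,1), (0,1) and [sqc] to the
   centre. *)
Definition sq0 q : R := Num.max 0 (1 - q.1 - q.2).
Definition sq1 q : R := Num.max 0 (q.1 - q.2).
Definition sq2 q : R := Num.max 0 (q.1 + q.2 - 1).
Definition sq3 q : R := Num.max 0 (q.2 - q.1).
Definition sqc q : R := 1 - `|1 - q.1 - q.2| - `|q.1 - q.2|.

Lemma max0E (y : R) : Num.max 0 y = (y + `|y|) / 2.
Proof.
have [y0|y0] := leP 0 y; first by rewrite ger0_norm//; lra.
by rewrite ltr0_norm//; lra.
Qed.

Lemma sq_sum q : sq0 q + sq1 q + sq2 q + sq3 q + sqc q = 1.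
Proof.
rewrite /sq0 /sq1 /sq2 /sq3 /sqc !max0E.
have -> : q.1 + q.2 - 1 = - (1 - q.1 - q.2) by ring.
have -> : q.2 - q.1 = - (q.1 - q.2) by ring.
by rewrite !normrN; lra.
Qed.

(** Each point is the barycentric combination of the corners and the centre [(1/2, 1/2)]; this is
    its first component, and the next lemma its second. *)
Lemma sq_inv1 q : sq1 q + sq2 q + sqc q / 2 = q.1.
Proof.
rewrite /sq1 /sq2 /sqc !max0E.
have -> : q.1 + q.2 - 1 = - (1 - q.1 - q.2) by ring.
by rewrite !normrN; lra.
Qed.

Lemma sq_inv2 q : sq2 q + sq3 q + sqc q / 2 = q.2.
Proof.
rewrite /sq2 /sq3 /sqc !max0E.
have -> : q.1 + q.2 - 1 = - (1 - q.1 - q.2) by ring.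
have -> : q.2 - q.1 = - (q.1 - q.2) by ring.
by rewrite !normrN; lra.
Qed.

Lemma sq_ge0 q : [/\ 0 <= sq0 q, 0 <= sq1 q, 0 <= sq2 q & 0 <= sq3 q].
Proof. by split; rewrite le_max lexx. Qed.

Lemma sqc_ge0 q : closed_square q -> 0 <= sqc q.
Proof.
rewrite /closed_square /= !in_itv /= => -[/andP[? ?] /andP[? ?]]; rewrite /sqc.
by have [?|?] := ler0P (1 - q.1 - q.2); have [?|?] := ler0P (q.1 - q.2); lra.
Qed.

Lemma sqc_gt0 q : open_square q -> 0 < sqc q.
Proof.
rewrite /open_square /= !in_itv /= => -[/andP[? ?] /andP[? ?]]; rewrite /sqc.
by have [?|?] := ler0P (1 - q.1 - q.2); have [?|?] := ler0P (q.1 - q.2); lra.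
Qed.

Lemma sq_opp q : (sq0 q = 0 \/ sq2 q = 0) /\ (sq1 q = 0 \/ sq3 q = 0).
Proof.
have max0 (y : R) : y <= 0 -> Num.max 0 y = 0 by move=> ?; apply/max_idPl.
rewrite /sq0 /sq1 /sq2 /sq3; split.
  have [h|h] : 1 - q.1 - q.2 <= 0 \/ 0 <= 1 - q.1 - q.2 by apply/orP; exact: le_total.
    by left; exact: max0.
  by right; apply: max0; lra.
have [h|h] : q.1 - q.2 <= 0 \/ 0 <= q.1 - q.2 by apply/orP; exact: le_total.
  by left; exact: max0.
by right; apply: max0; lra.
Qed.

(* At most two adjacent corners have positive coordinates, whence the products
   vanishing along both diagonals. *)
Lemma sq_of_coords (x0 x1 x2 x3 xc : R) :
  0 <= x0 -> 0 <= x1 -> 0 <= x2 -> 0 <= x3 -> 0 <= xc ->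
  x0 + x1 + x2 + x3 + xc = 1 -> x0 = 0 \/ x2 = 0 -> x1 = 0 \/ x3 = 0 ->
  let q := (x1 + x2 + xc / 2, x2 + x3 + xc / 2) in
  [/\ closed_square q, 0 < xc -> open_square q
    & [/\ sq0 q = x0, sq1 q = x1, sq2 q = x2, sq3 q = x3 & sqc q = xc]].
Proof.
move=> x00 x10 x20 x30 xc0 sum1 opp1 opp2 q.
have E1 : 1 - q.1 - q.2 = x0 - x2 by rewrite /q /=; lra.
have E2 : q.1 - q.2 = x1 - x3 by rewrite /q /=; lra.
split.
- by rewrite /closed_square /= !in_itv /=; split; apply/andP; split; lra.
- by move=> xc1; rewrite /open_square /= !in_itv /=; split; apply/andP; split; lra.
rewrite /sq0 /sq1 /sq2 /sq3 /sqc !max0E.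
have -> : q.1 + q.2 - 1 = - (1 - q.1 - q.2) by ring.
have -> : q.2 - q.1 = - (q.1 - q.2) by ring.
rewrite !normrN E1 E2.
have -> : `|x0 - x2| = x0 + x2.
  by case: opp1 => ->; rewrite ?subr0 ?sub0r ?normrN ?add0r ?addr0 ger0_norm.
have -> : `|x1 - x3| = x1 + x3.
  by case: opp2 => ->; rewrite ?subr0 ?sub0r ?normrN ?add0r ?addr0 ger0_norm.
by split; lra.
Qed.

Lemma continuous_sq : [/\ continuous sq0, continuous sq1, continuous sq2,
  continuous sq3 & continuous sqc].
Proof.
have c1 := @fcont_fst R; have c2 := @fcont_snd R.
have cc := @fcont_cst R (R * R)%type.
by split; do ?[apply: fcont_max => //]; do ?[apply: fcontB => //];
  do ?[apply: fcont_norm => //]; do ?[apply: fcontB => //]; do ?[apply: fcontD => //].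
Qed.

End SquareCoordinates.

Section QuadComplex.
Variables (R : realType) (G : simple_graph) (F : finType).
Variable side : F -> rel (vertex G).
Local Notation V := (vertex G).
Local Notation X := (V + F)%type.
Implicit Types (u v : V) (f g : F).

Definition quad_sides v0 v1 v2 v3 : seq (V * V) :=
  [:: (v0, v1); (v1, v0); (v1, v2); (v2, v1); (v2, v3); (v3, v2); (v3, v0); (v0, v3)].

Definition quad f v0 v1 v2 v3 :=
  uniq [:: v0; v1; v2; v3] /\
  forall u v, side f u v = ((u, v) \in quad_sides v0 v1 v2 v3).

Definition tri (x y z : X) : bool :=
  match x, y, z with
  | inl u, inl v, inr f | inl u, inr f, inl v | inr f, inl u, inl v => side f u v
  | _, _, _ => false
  end.

Hypothesis side_sym : forall f, symmetric (side f).
Hypothesis side_adj : forall f u v, side f u v -> adj u v.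
Hypothesis quad_ex : forall f, exists v0 v1 v2 v3, quad f v0 v1 v2 v3.

Lemma tri_swap12 x y z : tri x y z -> tri y x z.
Proof. by case: x y z => [u|f] [v|g] [w|h] //=; rewrite side_sym. Qed.

Lemma tri_swap23 x y z : tri x y z -> tri x z y.
Proof. by case: x y z => [u|f] [v|g] [w|h] //=; rewrite side_sym. Qed.

Lemma tri_neq12 x y z : tri x y z -> x != y.
Proof.
case: x y z => [u|f] [v|g] [w|h] //= /side_adj.
by apply: contraTneq => -[->]; rewrite adj_irr.
Qed.

Local Notation space := (@space R X tri).
Local Notation polyhedron := (@polyhedron R X tri).
Variable p0 : space.

Section OneQuad.
Variables (f : F) (v0 v1 v2 v3 : V).
Hypothesis fq : quad f v0 v1 v2 v3.

Definition quad_crd (q : R * R) : X -> R := fun z =>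
  match z with
  | inl v => sq0 q *+ (v == v0) + sq1 q *+ (v == v1)
             + sq2 q *+ (v == v2) + sq3 q *+ (v == v3)
  | inr g => sqc q *+ (g == f)
  end.

Lemma quad_neq : [/\ v0 != v1, v0 != v2, v0 != v3, v1 != v2 & v1 != v3 /\ v2 != v3].
Proof.
have [] := fq; rewrite /= !inE !negb_or => /and4P[/and3P[? ? ?] /andP[? ?] ? _] _.
by [].
Qed.

Lemma quad_crdE q : [/\ quad_crd q (inl v0) = sq0 q, quad_crd q (inl v1) = sq1 q,
  quad_crd q (inl v2) = sq2 q, quad_crd q (inl v3) = sq3 q & quad_crd q (inr f) = sqc q].
Proof.
have [n01 n02 n03 n12 [n13 n23]] := quad_neq.
rewrite /quad_crd !eqxx !(eq_sym v1 v0) !(eq_sym v2 v0) !(eq_sym v3 v0).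
rewrite !(eq_sym v2 v1) !(eq_sym v3 v1) !(eq_sym v3 v2).
rewrite (negbTE n01) (negbTE n02) (negbTE n03) (negbTE n12) (negbTE n13) (negbTE n23).
by rewrite !mulr0n !mulr1n !addr0 !add0r.
Qed.

Lemma quad_crd_out q z : z \notin [:: inl v0; inl v1; inl v2; inl v3; inr f] ->
  quad_crd q z = 0.
Proof.
rewrite !inE !negb_or => /and5P[h0 h1 h2 h3 h4].
case: z h0 h1 h2 h3 h4 => [v|g] /=; rewrite !(inj_eq inl_inj, inj_eq inr_inj).
  by move=> /negbTE -> /negbTE -> /negbTE -> /negbTE -> _; rewrite !mulr0n !addr0.
by move=> _ _ _ _ /negbTE ->.
Qed.

Lemma quad_side : [/\ side f v0 v1, side f v1 v2, side f v2 v3 & side f v3 v0].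
Proof. by have [_ ->] := fq; split; rewrite ?(proj2 fq) !inE !eqxx ?orbT. Qed.

Definition cface g : set space := [set p | exists a b,
  side g a b /\ in_tri (crd p) (inl a) (inl b) (inr g)].

Lemma quad_crd_tri q : closed_square q ->
  exists a b, side f a b /\ in_tri (quad_crd q) (inl a) (inl b) (inr f).
Proof.
move=> qsq; have [s01 s12 s23 s30] := quad_side.
have [q0 q1 q2 q3] := sq_ge0 q; have qc := sqc_ge0 qsq.
have [E0 E1 E2 E3 Ec] := quad_crdE q; have qsum := sq_sum q.
have ge0 z : 0 <= quad_crd q z.
  by case: z => [v|g] /=; rewrite ?addr_ge0// mulrn_wge0.
have out z : z \notin [:: inl v0; inl v1; inl v2; inl v3; inr f] -> quad_crd q z = 0.
  exact: quad_crd_out.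
(* One corner of each diagonal has coordinate 0; the two that remain are adjacent and name the
   triangle containing [q]. *)
have [[h02|h02] [h13|h13]] := sq_opp q.
- exists v2, v3; split=> //; split=> //; last by rewrite E2 E3 Ec; lra.
  move=> z; rewrite !inE !negb_or => /and3P[n2 n3 nc].
  have [->|n0] := eqVneq z (inl v0); first by rewrite E0.
  have [->|n1] := eqVneq z (inl v1); first by rewrite E1.
  by rewrite out// !inE !negb_or n0 n1 n2 n3.
- exists v1, v2; split=> //; split=> //; last by rewrite E1 E2 Ec; lra.
  move=> z; rewrite !inE !negb_or => /and3P[n1 n2 nc].
  have [->|n0] := eqVneq z (inl v0); first by rewrite E0.
  have [->|n3] := eqVneq z (inl v3); first by rewrite E3.
  by rewrite out// !inE !negb_or n0 n1 n2 n3.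
- exists v3, v0; split=> //; split=> //; last by rewrite E3 E0 Ec; lra.
  move=> z; rewrite !inE !negb_or => /and3P[n3 n0 nc].
  have [->|n1] := eqVneq z (inl v1); first by rewrite E1.
  have [->|n2] := eqVneq z (inl v2); first by rewrite E2.
  by rewrite out// !inE !negb_or n0 n1 n2 n3.
- exists v0, v1; split=> //; split=> //; last by rewrite E0 E1 Ec; lra.
  move=> z; rewrite !inE !negb_or => /and3P[n0 n1 nc].
  have [->|n2] := eqVneq z (inl v2); first by rewrite E2.
  have [->|n3] := eqVneq z (inl v3); first by rewrite E3.
  by rewrite out// !inE !negb_or n0 n1 n2 n3.
Qed.

Lemma polyhedron_quad q : closed_square q -> polyhedron (quad_crd q).
Proof.
by move=> /quad_crd_tri[a [b [ab H]]]; exists (inl a), (inl b), (inr f).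
Qed.

Definition quad_map q : space := mk p0 (quad_crd q).

Lemma crd_quad_map q : closed_square q -> crd (quad_map q) = quad_crd q.
Proof. by move=> /polyhedron_quad; exact: mkK. Qed.

Definition quad_inv (x : X -> R) : R * R :=
  (x (inl v1) + x (inl v2) + x (inr f) / 2, x (inl v2) + x (inl v3) + x (inr f) / 2).

Lemma quad_crdK q : quad_inv (quad_crd q) = q.
Proof.
have [E0 E1 E2 E3 Ec] := quad_crdE q.
by rewrite /quad_inv E1 E2 E3 Ec sq_inv1 sq_inv2 -surjective_pairing.
Qed.

(** In a triangle over one side, the other two corners have coordinate 0, and they lie on different
    diagonals. So the hypotheses of [sq_of_coords] hold on all four triangles, and [quad_inv] is one
    chart for the closed quadrilateral. *)
Lemma cface_quad p : cface f p ->
  [/\ closed_square (quad_inv (crd p)),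
    0 < crd p (inr f) -> open_square (quad_inv (crd p))
    & quad_crd (quad_inv (crd p)) = crd p].
Proof.
move=> [a [b [ab [x0 xout xsum]]]].
have [n01 n02 n03 n12 [n13 n23]] := quad_neq.
have l_neq u v : u != v -> (inl u == inl v :> X) = false by move=> /negbTE; rewrite (inj_eq inl_inj).
have main : [/\ crd p (inl v0) + crd p (inl v1) + crd p (inl v2) + crd p (inl v3)
                  + crd p (inr f) = 1,
    crd p (inl v0) = 0 \/ crd p (inl v2) = 0, crd p (inl v1) = 0 \/ crd p (inl v3) = 0
    & forall z, z \notin [:: inl v0; inl v1; inl v2; inl v3; inr f] -> crd p z = 0].
  have [_ sE] := fq; rewrite sE !inE !xpair_eqE in ab.
  have m01 := n01; have m02 := n02; have m03 := n03; have m12 := n12; have m13 := n13; have m23 := n23.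
  rewrite eq_sym in m01; rewrite eq_sym in m02; rewrite eq_sym in m03.
  rewrite eq_sym in m12; rewrite eq_sym in m13; rewrite eq_sym in m23.
  have o v : v != a -> v != b -> crd p (inl v) = 0.
    by move=> va vb; apply: xout; rewrite !inE !l_neq.
  have o' z : a \in [:: v0; v1; v2; v3] -> b \in [:: v0; v1; v2; v3] ->
      z \notin [:: inl v0; inl v1; inl v2; inl v3; inr f] -> crd p z = 0.
    move=> aq bq zn; apply: xout; apply: contra zn.
    have L c : c \in [:: v0; v1; v2; v3] ->
        (inl c : X) \in [:: inl v0; inl v1; inl v2; inl v3; inr f].
      by rewrite !inE !(inj_eq inl_inj) orbF.
    rewrite in_cons [z \in [:: _; _]]in_cons mem_seq1.
    case/or3P => /eqP ->; [exact: L|exact: L|by rewrite !inE eqxx !orbT].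
  have fin : a \in [:: v0; v1; v2; v3] /\ b \in [:: v0; v1; v2; v3].
    by move: ab; rewrite !inE; repeat (case/orP);
      move/andP=> [/eqP -> /eqP ->]; rewrite !eqxx ?orbT.
  have [fa fb] := fin.
  split; last by move=> z; exact: o'.
  - move: ab o xsum; repeat (case/orP); move=> /andP[/eqP -> /eqP ->] o xsum;
      try (have ? : crd p (inl v0) = 0 by apply: o);
      try (have ? : crd p (inl v1) = 0 by apply: o);
      try (have ? : crd p (inl v2) = 0 by apply: o);
      try (have ? : crd p (inl v3) = 0 by apply: o);
      lra.
  - move: ab o; repeat (case/orP); move=> /andP[/eqP -> /eqP ->] o;
      first [by left; apply: o | by right; apply: o].
  - move: ab o; repeat (case/orP); move=> /andP[/eqP -> /eqP ->] o;
      first [by left; apply: o | by right; apply: o].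
have [sum1 o02 o13 out] := main.
have [cs os [E0 E1 E2 E3 Ec]] :=
  sq_of_coords (x0 _) (x0 _) (x0 _) (x0 _) (x0 _) sum1 o02 o13.
split=> //; apply/funext => z.
have [F0 F1 F2 F3 Fc] := quad_crdE (quad_inv (crd p)).
have [zin|zout] := boolP (z \in [:: inl v0; inl v1; inl v2; inl v3; inr f]).
  by move: zin; rewrite !inE; repeat (case/orP); move=> /eqP ->;
    rewrite ?F0 ?F1 ?F2 ?F3 ?Fc.
by rewrite quad_crd_out// out.
Qed.

Lemma within_quad_map : {within @closed_square R, continuous quad_map}.
Proof.
apply: within_mk => [z|q]; last exact: polyhedron_quad.
apply: continuous_subspaceT; have [c0 c1 c2 c3 cc] := @continuous_sq R.
have cM (h : R * R -> R) (b : bool) : continuous h -> continuous (fun q => h q *+ b).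
  by case: b => //= _; exact: fcont_cst.
by case: z => [v|g] /=; do ?[apply: fcontD]; exact: cM.
Qed.

Lemma open_closed_square : @open_square R `<=` @closed_square R.
Proof.
move=> q; rewrite /open_square /closed_square /= !in_itv /=.
by move=> [/andP[? ?] /andP[? ?]]; split; apply/andP; split; exact: ltW.
Qed.

Lemma cface_compact : compact (cface f).
Proof.
have -> : cface f = quad_map @` @closed_square R.
  apply/seteqP; split=> [p fp|_ [q qsq <-]].
    have [cs _ E] := cface_quad fp; exists (quad_inv (crd p)) => //.
    by apply: crd_inj; rewrite crd_quad_map.
  by have := quad_crd_tri qsq; rewrite -crd_quad_map.
apply: continuous_compact; first exact: within_quad_map.
by apply: compact_setX; exact: segment_compact.
Qed.

Lemma star_cface p : star (inr f) p -> cface f p.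
Proof.
move=> fp; have [a [b [fab H]]] := star_tri tri_swap12 tri_swap23 fp.
case: a b fab H => [a|//] [b|//] fab H; exists a, b; split=> //.
by apply/in_tri_swap23/in_tri_swap12.
Qed.

Lemma quad_homeomorphism : homeomorphism (@open_square R) (star (inr f)) quad_map.
Proof.
apply: (@homeomorphism_intro _ _ _ _ _ (fun p => quad_inv (crd p))).
- exact: continuous_subspaceW open_closed_square within_quad_map.
- have cc z := @continuous_crd R X tri z.
  have ch z : continuous (fun p : space => crd p z / 2).
    by apply: fcontM => //; exact: fcont_cst.
  by apply: within_pair; apply: continuous_subspaceT; apply: fcontD => //; apply: fcontD.
- move=> _ [q qo <-]; rewrite /star /= crd_quad_map; last exact: open_closed_square.
  by have [_ _ _ _ ->] := quad_crdE q; exact: sqc_gt0.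
- by move=> _ [p fp <-]; have [_ h _] := cface_quad (star_cface fp); exact: h.
- move=> q qo; rewrite crd_quad_map; last exact: open_closed_square.
  exact: quad_crdK.
- move=> p fp; have [cs _ E] := cface_quad (star_cface fp).
  by apply: crd_inj; rewrite crd_quad_map.
Qed.

Lemma quad_crd_sides t : 0 <= t <= 1 ->
  [/\ quad_crd (t, 0) = seg (inl v0) (inl v1) t,
      quad_crd (1, t) = seg (inl v1) (inl v2) t,
      quad_crd (1 - t, 1) = seg (inl v2) (inl v3) t
    & quad_crd (0, 1 - t) = seg (inl v3) (inl v0) t].
Proof.
move=> /andP[t0 t1].
have m0 (y : R) : y <= 0 -> Num.max 0 y = 0 by move=> ?; apply/max_idPl.
have mp (y : R) : 0 <= y -> Num.max 0 y = y by move=> ?; apply/max_idPr.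
have sg a b s : seg (inl a) (inl b) s = fun z : X =>
    match z with inl v => (1 - s) *+ (v == a) + s *+ (v == b) | inr _ => 0 end.
  apply/funext => -[v|g]; rewrite /seg ?(inj_eq inl_inj)//=.
  by rewrite !mulr0n addr0.
have nr (y : R) : 0 <= y -> `|y| = y by move=> ?; rewrite ger0_norm.
have np (y : R) : y <= 0 -> `|y| = - y by move=> ?; rewrite ler0_norm.
split; apply/funext => -[v|g]; rewrite sg /quad_crd /sq0 /sq1 /sq2 /sq3 /sqc /=.
- by rewrite (mp (1 - t - 0)) ?(mp (t - 0)) ?(m0 (t + 0 - 1)) ?(m0 (0 - t)); lra.
- by rewrite (nr (1 - t - 0)) ?(nr (t - 0)); lra.
- by rewrite (m0 (1 - 1 - t)) ?(mp (1 - t)) ?(mp (1 + t - 1)) ?(m0 (t - 1)); lra.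
- by rewrite (np (1 - 1 - t)) ?(nr (1 - t)); lra.
- by rewrite (m0 (1 - (1 - t) - 1)) ?(m0 (1 - t - 1)) ?(mp (1 - t + 1 - 1))
    ?(mp (1 - (1 - t))); lra.
- by rewrite (np (1 - (1 - t) - 1)) ?(np (1 - t - 1)); lra.
- by rewrite (mp (1 - 0 - (1 - t))) ?(m0 (0 - (1 - t))) ?(m0 (0 + (1 - t) - 1))
    ?(mp (1 - t - 0)); lra.
- by rewrite (nr (1 - 0 - (1 - t))) ?(np (0 - (1 - t))); lra.
Qed.

Lemma quad_map_sides t : 0 <= t <= 1 ->
  [/\ quad_map (t, 0) = mk p0 (seg (inl v0) (inl v1) t),
      quad_map (1, t) = mk p0 (seg (inl v1) (inl v2) t),
      quad_map (1 - t, 1) = mk p0 (seg (inl v2) (inl v3) t)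
    & quad_map (0, 1 - t) = mk p0 (seg (inl v3) (inl v0) t)].
Proof. by move=> /quad_crd_sides[E0 E1 E2 E3]; rewrite /quad_map E0 E1 E2 E3. Qed.

End OneQuad.
End QuadComplex.

(** * The closed surface and its embedded graph *)

Section QuadSurface.
Variables (R : realType) (G : simple_graph) (F : finType).
Variable side : F -> rel (vertex G).
Local Notation V := (vertex G).
Local Notation X := (V + F)%type.
Implicit Types (u v : V) (f g : F).

Hypothesis side_sym : forall f, symmetric (side f).
Hypothesis side_adj : forall f u v, side f u v -> adj u v.
Hypothesis quad_ex : forall f, exists v0 v1 v2 v3, quad side f v0 v1 v2 v3.
Variable colour : V -> bool.
Hypothesis adj_colour : forall u v, adj u v -> colour u != colour v.
Hypothesis edge_two_faces : forall u v, adj u v ->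
  exists f g, f != g /\ forall h, side h u v = (h == f) || (h == g).
(** Faces at [v] that share an edge at [v]; connectedness of this relation excludes pinch points. *)
Definition corner_adj v : rel F := fun f g => [exists u, side f v u && side g v u].
Hypothesis corner_connect : forall v f g u w,
  side f v u -> side g v w -> connect (corner_adj v) f g.
Hypothesis graph_connect : forall u v, connect (@adj G) u v.
Hypothesis vertex_adj : forall v, exists u, adj v u.

Local Notation tri := (tri side).
Local Notation space := (@space R X tri).
Let tri12 := tri_swap12 side_sym.
Let tri23 := tri_swap23 side_sym.
Let trin := tri_neq12 side_adj.
Variable p0 : space.

Lemma quad_other f v u : side f v u ->
  exists w, [/\ w != u, side f v w & forall w', side f v w' -> w' = u \/ w' = w].
Proof.
have [v0 [v1 [v2 [v3 fq]]]] := quad_ex f.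
have [n01 n02 n03 n12 [n13 n23]] := quad_neq fq; have [_ sE] := fq.
have m01 := n01; have m02 := n02; have m03 := n03; have m12 := n12; have m13 := n13; have m23 := n23.
rewrite eq_sym in m01; rewrite eq_sym in m02; rewrite eq_sym in m03.
rewrite eq_sym in m12; rewrite eq_sym in m13; rewrite eq_sym in m23.
have s0 w : side f v0 w -> w = v1 \/ w = v3.
  rewrite sE !inE !xpair_eqE eqxx (negbTE n01) (negbTE n02) (negbTE n03) /= ?orbF ?orFb.
  by case/orP => /eqP; [left|right].
have s1 w : side f v1 w -> w = v0 \/ w = v2.
  rewrite sE !inE !xpair_eqE eqxx (negbTE m01) (negbTE n12) (negbTE n13) /= ?orbF ?orFb.
  by case/orP => /eqP; [left|right].
have s2 w : side f v2 w -> w = v1 \/ w = v3.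
  rewrite sE !inE !xpair_eqE eqxx (negbTE m02) (negbTE m12) (negbTE n23) /= ?orbF ?orFb.
  by case/orP => /eqP; [left|right].
have s3 w : side f v3 w -> w = v2 \/ w = v0.
  rewrite sE !inE !xpair_eqE eqxx (negbTE m03) (negbTE m13) (negbTE m23) /= ?orbF ?orFb.
  by case/orP => /eqP; [left|right].
have [S01 S12 S23 S30] := quad_side fq.
have S10 : side f v1 v0 by rewrite side_sym.
have S21 : side f v2 v1 by rewrite side_sym.
have S32 : side f v3 v2 by rewrite side_sym.
have S03 : side f v0 v3 by rewrite side_sym.
rewrite sE !inE !xpair_eqE; repeat (case/orP); move=> /andP[/eqP -> /eqP ->].
- by exists v3.
- by exists v2.
- by exists v0; split=> // w /s1[]; [right|left].
- by exists v3.
- by exists v1; split=> // w /s2[]; [right|left].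
- by exists v0.
- by exists v2; split=> // w /s3[]; [right|left].
- by exists v1; split=> // w /s0[]; [right|left].
Qed.

Lemma face_of_adj u v : adj u v -> exists f, side f u v.
Proof. by move=> /edge_two_faces[f [g [_ fE]]]; exists f; rewrite fE eqxx. Qed.

(** Links are two-regular for two reasons: an edge of the graph lies on two faces, and a corner of a
    quadrilateral lies on two of its sides. *)
Lemma tri_deg2 z a b : tri z a b ->
  exists c, [/\ c != b, tri z a c & forall d, tri z a d -> d = b \/ d = c].
Proof.
case: z a b => [v|f] [u|g] [w|h] //= vu.
- have [f1 [f2 [f12 fE]]] := edge_two_faces (side_adj vu).
  move: (vu); rewrite fE => /orP[]/eqP ->.
    exists (inr f2); split; first by rewrite (inj_eq inr_inj) eq_sym.
      by rewrite fE eqxx orbT.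
    by move=> [//|k]; rewrite fE => /orP[]/eqP ->; [left|right].
  exists (inr f1); split; first by rewrite (inj_eq inr_inj).
    by rewrite fE eqxx.
  by move=> [//|k]; rewrite fE => /orP[]/eqP ->; [right|left].
- have [x [xw sx xE]] := quad_other vu.
  exists (inl x); split=> //.
  by move=> [d|//] /xE[] ->; [left|right].
- have [x [xw sx xE]] := quad_other vu.
  exists (inl x); split=> //.
  by move=> [d|//] /xE[] ->; [left|right].
Qed.

Lemma tri_link_connect z : exists y0 y1, tri z y0 y1 /\
  forall a b, tri z a b -> connect [rel a b | tri z a b] y0 a.
Proof.
case: z => [v|f].
- have [u vu] := vertex_adj v; have [f fvu] := face_of_adj vu.
  exists (inr f), (inl u); split=> //.
  set e := [rel a b | _].
  have path_face g g' : connect (corner_adj v) g g' -> connect e (inr g) (inr g').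
    move=> /connectP[p]; elim: p g => [|h p IH] g /=; first by move=> _ ->.
    move=> /andP[/existsP[w /andP[gw hw]] hp] gE.
    apply: connect_trans _ (IH _ hp gE).
    by apply: (connect_trans (y := inl w)); apply: connect1.
  move=> [w|g] [w'|g'] //= H.
    apply: (connect_trans (path_face f g' (corner_connect fvu H))).
    by apply: connect1.
  exact: path_face (corner_connect fvu H).
- have [v0 [v1 [v2 [v3 fq]]]] := quad_ex f.
  have [S01 S12 S23 S30] := quad_side fq.
  exists (inl v0), (inl v1); split=> // -[a|//] [b|//] /=.
  set e := [rel a b | _].
  have e01 : connect e (inl v0) (inl v1) by apply: connect1.
  have e02 : connect e (inl v0) (inl v2) by apply: connect_trans e01 _; apply: connect1.
  have e03 : connect e (inl v0) (inl v3) by apply: connect_trans e02 _; apply: connect1.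
  have [_ ->] := fq; rewrite !inE !xpair_eqE.
  by repeat (case/orP); move=> /andP[/eqP -> _].
Qed.

Lemma disk_star z : open_disk R (star z : set space).
Proof.
have [y0 [y1 [ty conn]]] := tri_link_connect z.
have [|||s [us s3 sP]] := @two_regular_cycle X [rel a b | tri z a b] _ _ _ z y0 y1 ty conn.
- by move=> a b /=; apply/idP/idP => /tri23.
- move=> a /=; apply/negbTE/negP => h.
  by have := tri_neq23 tri12 tri23 trin h; rewrite eqxx.
- by move=> a b /= /tri_deg2.
have zs : z \notin s.
  apply/negP => /(nthP z)[k kS kz].
  have : tri z (nth z s k) (nth z s (if k == (size s).-1 then 0%N else k.+1)).
    by apply/sP; exists k => //; left.
  by move=> /trin; rewrite kz eqxx.
(* The fan needs at least four rays. Around a graph vertex the link alternates between vertices and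
   centres, so its length is not 3; around a centre, length 3 would give three mutually adjacent
   vertices, against the 2-colouring. *)
have s4 : (3 < size s)%N.
  have [//|s3'] := ltnP 3 (size s).
  have {s3 s3'}s3 : size s = 3 by apply/eqP; rewrite eqn_leq s3' s3.
  have t0 : tri z (nth z s 0) (nth z s 1) by apply/sP; exists 0%N; rewrite ?s3//; left.
  have t1 : tri z (nth z s 1) (nth z s 2) by apply/sP; exists 1%N; rewrite ?s3//; left.
  have t2 : tri z (nth z s 2) (nth z s 0) by apply/sP; exists 2%N; rewrite ?s3//; left.
  move: t0 t1 t2; clear sP conn ty us zs.
  case: (nth z s 0) (nth z s 1) (nth z s 2) => [a|a] [b|b] [c|c]; case: z => [z|z] //=.
  move=> /side_adj/adj_colour ab /side_adj/adj_colour bc /side_adj/adj_colour ca.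
  by move: ab bc ca; case: (colour a) (colour b) (colour c) => -[] [].
have [M sM] : exists M, size s = M.+2 by case: (size s) s3 => [|[|M]] // _; exists M.
have M2 : (1 < M)%N by rewrite sM in s4.
apply: (@star_disk R X tri tri12 tri23 z M s p0 M2 sM us zs).
by move=> a b; rewrite sP sM; split=> -[k kS H]; exists k.
Qed.

Lemma adj_tri u v : adj u v -> exists f, tri (inl u) (inl v) (inr f).
Proof. exact: face_of_adj. Qed.

Definition qpt v : space := vtx p0 (inl v).
Definition qarc u v (t : R) : space := mk p0 (seg (inl u) (inl v) t).

Lemma crd_qarc u v t : adj u v -> 0 <= t <= 1 ->
  crd (qarc u v t) = seg (inl u) (inl v) t.
Proof.
by move=> /adj_tri[f tf] t01; apply: mkK; exact: (polyhedron_seg tri12 tri23 trin tf).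
Qed.

Lemma crd_qpt v : crd (qpt v) = seg (inl v) (inl v) 0.
Proof.
have [u /adj_tri[f tf]] := vertex_adj v; exact: (crd_vtx tri12 tri23 trin p0 tf).
Qed.

Lemma qpt_inj : injective qpt.
Proof.
move=> u v /(congr1 (@crd R X tri))/(congr1 (fun h => h (inl u))).
rewrite !crd_qpt /seg eqxx !mul0rn !addr0 subr0.
by case: eqP => [[]//|_] /eqP; rewrite oner_eq0.
Qed.

Lemma neq_inl u v : adj u v -> (inl u : X) != inl v.
Proof. by apply: contraTneq => -[->]; rewrite adj_irr. Qed.

Lemma in01 (t : R) : t \in `[0, 1] -> 0 <= t <= 1.
Proof. by rewrite in_itv. Qed.

Lemma in01o (t : R) : t \in `]0, 1[ -> 0 <= t <= 1.
Proof. by rewrite in_itv /= => /andP[? ?]; rewrite !ltW. Qed.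

Lemma qarc_continuous u v : adj u v -> {within `[0, 1]%classic, continuous (qarc u v)}.
Proof.
move=> uv; apply: within_mk => [z|t t01]; last first.
  have [f tf] := adj_tri uv; apply: (polyhedron_seg tri12 tri23 trin tf).
  by move: t01; rewrite /= in_itv.
apply: continuous_subspaceT.
have cid : continuous (fun x : R => x) by move=> ?; exact: cvg_id.
have cM (h : R -> R) (b : bool) : continuous h -> continuous (fun q => h q *+ b).
  by case: b => //= _; exact: fcont_cst.
by apply: fcontD; apply: cM => //; apply: fcontB => //; exact: fcont_cst.
Qed.

Lemma qarc_inj u v : adj u v -> set_inj `[0, 1]%classic (qarc u v).
Proof.
move=> uv s t; rewrite !inE /= !in_itv /= => s01 t01.
move=> /(congr1 (@crd R X tri))/(congr1 (fun h => h (inl v))).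
by rewrite !crd_qarc// !seg_r ?neq_inl.
Qed.

Lemma qarc_avoids u v w t : adj u v -> t \in `]0, 1[ -> qarc u v t <> qpt w.
Proof.
move=> uv t01 /(congr1 (@crd R X tri))/(congr1 (fun h => h (inl u))).
rewrite crd_qarc ?in01o// crd_qpt seg_l ?neq_inl// /seg mul0rn addr0 subr0.
by move: t01; rewrite in_itv /= => /andP[? ?]; case: eqP => _ /=; lra.
Qed.

Lemma qarc_disjoint u v u' v' t t' : adj u v -> adj u' v' ->
  t \in `]0, 1[ -> t' \in `]0, 1[ -> qarc u v t = qarc u' v' t' ->
  (u = u' /\ v = v') \/ (u = v' /\ v = u').
Proof.
move=> uv uv' t01 t01' /(congr1 (@crd R X tri)).
rewrite !crd_qarc ?in01o// => E.
have Eu := congr1 (fun h => h (inl u)) E; have Ev := congr1 (fun h => h (inl v)) E.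
move: Eu Ev; rewrite /= seg_l ?neq_inl// seg_r ?neq_inl// /seg.
move: t01 t01'; rewrite !in_itv /= => /andP[t0 t1] _.
rewrite !(inj_eq inl_inj) => Eu Ev.
have hu : (u == u') || (u == v').
  apply: contraT; rewrite negb_or => /andP[/negbTE n1 /negbTE n2].
  by move: Eu t1; rewrite n1 n2 addr0 => /eqP; rewrite subr_eq0 => /eqP <-; rewrite ltxx.
have hv : (v == u') || (v == v').
  apply: contraT; rewrite negb_or => /andP[/negbTE n1 /negbTE n2].
  by move: Ev t0; rewrite n1 n2 addr0 => ->; rewrite ltxx.
case/orP: hu => /eqP hu; case/orP: hv => /eqP hv; [|by left|by right|];
  by move: uv; rewrite hu hv adj_irr.
Qed.

Definition quad_embedding : graph_embedding R G space.
Proof.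
refine (@GraphEmbedding R G space qpt qarc qpt_inj qarc_continuous qarc_inj _ _ _
  qarc_avoids qarc_disjoint).
- by move=> u v uv; rewrite /qarc seg0.
- by move=> u v uv; rewrite /qarc seg1.
- by move=> u v t uv _; rewrite /qarc seg_rev.
Defined.

(** Every triangle has exactly one centre. A point whose coordinate there vanishes lies on the
    opposite side, an edge [uv], at the parameter given by its coordinate at [v]. *)
Lemma graph_imageP p : ~ graph_image quad_embedding p <-> exists f, star (inr f) p.
Proof.
split=> [np|[f fp] [[v pE]|[u [v [t [uv t01 pE]]]]]].
- have [x [y [z [xyz H]]]] := crd_polyhedron p.
  suff [u [v [f [uvf Huvf]]]] : exists u v f, side f u v /\ in_tri (crd p) (inl u) (inl v) (inr f).
    have [x0 xout xsum] := Huvf; have uv := side_adj uvf.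
    have [f0|f0] := eqVneq (crd p (inr f)) 0; last first.
      by exists f; rewrite /star /= lt_def f0 x0.
    case: np; right; exists u, v, (crd p (inl v)); split=> //.
      by rewrite in_itv /= x0 /=; have := x0 (inl u); lra.
    apply: crd_inj; rewrite [RHS]crd_qarc//; last by rewrite x0 /=; have := x0 (inl u); lra.
    apply/funext => w; have [->|wu] := eqVneq w (inl u); first by rewrite seg_l ?neq_inl//; lra.
    have [->|wv] := eqVneq w (inl v); first by rewrite seg_r ?neq_inl.
    rewrite seg_out//; have [->//|wf] := eqVneq w (inr f).
    by apply: xout; rewrite !inE !negb_or wu wv.
  case: x y z xyz H => [x|x] [y|y] [z|z] //= xyz H.
  + by exists x, y, z.
  + by exists x, z, y; split=> //; exact: in_tri_swap23.
  + by exists y, z, x; split=> //; apply/in_tri_swap23/in_tri_swap12.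
- move: fp; rewrite pE /star /= [crd _]crd_qpt seg_out// ltxx.
  by [].
- move: fp; rewrite pE /star /= [crd _]crd_qarc ?in01// seg_out// ltxx.
  by [].
Qed.

Lemma star_face_disjoint f g (p : space) : star (inr f) p -> star (inr g) p -> f = g.
Proof.
move=> /(star_cface side_sym)[a [b [_ [_ out _]]]] gp.
have [//|fg] := eqVneq f g.
by move: gp; rewrite /star /= out ?ltxx// !inE /= (inj_eq inr_inj) eq_sym (negbTE fg).
Qed.

Lemma star_face_connected f (p : space) : star (inr f) p -> exists A,
  [/\ connected A, A p, A (vtx p0 (inr f)) & A `<=` star (inr f)].
Proof.
move=> fp; have [a [b [fab H]]] := star_tri tri12 tri23 fp.
have [A [cA Ap Af le]] := cone_connected tri23 trin p0 fab H.
by exists A; split=> // q /le; apply: lt_le_trans.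
Qed.

(** The open stars of the centres are connected, open and pairwise disjoint, and they cover the
    complement of the graph. Hence the trace of one of them on a component is both open and
    closed. *)
Lemma star_component f (p : space) : star (inr f) p ->
  connected_component (~` graph_image quad_embedding) p = star (inr f).
Proof.
move=> fp; set C := connected_component _ _.
have gi_star g (q : space) : star (inr g) q -> (~` graph_image quad_embedding) q.
  by move=> gq; apply/graph_imageP; exists g.
have Cp : C p by apply: connected_component_refl; exact: gi_star fp.
apply/seteqP; split; last first.
  have [A [cA Ap Af As]] := star_face_connected fp.
  move=> q fq; have [B [cB Bq Bf Bs]] := star_face_connected fq.
  have cAB : connected (A `|` B) by apply: connectedU => //; exists (vtx p0 (inr f)).
  apply: (connected_component_max _ _ cAB); [by left| |by right].
  by move=> x [/As|/Bs]; exact: gi_star.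
have CC : connected C by exact: component_connected.
have Csub : C `<=` ~` graph_image quad_embedding by exact: connected_component_sub.
suff -> : C = C `&` star (inr f) by move=> x [].
apply/esym/CC; first by exists p.
- by exists (star (inr f)) => //; exact: open_star.
- exists (~` \bigcup_(g in [set g | g != f]) star (inr g)).
    by apply: open_closedC; apply: bigcup_open => g _; exact: open_star.
  apply/seteqP; split=> x [Cx xs]; split=> //.
    move=> [g /= gf gx]; move/eqP: gf; apply.
    exact: star_face_disjoint gx xs.
  have /graph_imageP[g gx] := Csub _ Cx.
  have [<-//|gf] := eqVneq g f.
  by case: xs; exists g.
Qed.

Lemma faceP A : face quad_embedding A -> exists f, A = star (inr f).
Proof.
by move=> [p np ->]; have [f fp] := (graph_imageP p).1 np; exists f; exact: star_component.
Qed.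

Lemma quad_embedding_quadrangular : quadrangular quad_embedding.
Proof.
split=> [A /faceP[f ->]|A /faceP[f ->]]; first exact: disk_star.
have [v0 [v1 [v2 [v3 fq]]]] := quad_ex f; exists v0, v1, v2, v3.
have [S01 S12 S23 S30] := quad_side fq.
split; do ?[exact: side_adj S01]; do ?[exact: side_adj S12];
  do ?[exact: side_adj S23]; do ?[exact: side_adj S30].
exists (quad_map p0 f v0 v1 v2 v3); split.
- exact: within_quad_map.
- exact: quad_homeomorphism.
- by move=> t /in01; exact: quad_map_sides.
Qed.

Definition linked (p q : space) := exists A, [/\ connected A, A p & A q].

Lemma linked_sym p q : linked p q -> linked q p.
Proof. by move=> [A []]; exists A. Qed.

Lemma linked_trans p q r : linked p q -> linked q r -> linked p r.
Proof.
move=> [A [cA Ap Aq]] [B [cB Bq Br]]; exists (A `|` B); split; [|by left|by right].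
by apply: connectedU => //; exists q.
Qed.

Lemma linked_vtx u v : linked (qpt u) (qpt v).
Proof.
have /connectP[s] := graph_connect u v.
elim: s u => [|w s IH] u /=.
  by move=> _ ->; exists [set qpt u]; split=> //; exact: connected1.
move=> /andP[uw ws] vE; apply: linked_trans (IH _ ws vE).
have [f tf] := adj_tri uw.
have H : in_tri (crd (qpt w)) (inl u) (inl w) (inr f).
  rewrite crd_qpt -(seg1 _ (inl u)).
  by apply: (in_tri_seg tri12 tri23 trin tf); rewrite lexx ler01.
have [A [cA Aw Au _]] := cone_connected tri23 trin p0 tf H.
by exists A.
Qed.

(** Compactness comes from the finitely many closed quadrilaterals. For connectedness, each point is
    joined to a vertex by a segment and vertices are joined along edges. Every point has a positive
    coordinate, hence lies in an open star, which is a disk. *)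
Lemma space_closed_surface : closed_surface R space.
Proof.
split.
- exact: space_hausdorff.
- have -> : [set: space] = \big[setU/set0]_(f <- enum F) cface f.
    apply/seteqP; split=> // p _; rewrite -bigcup_seq /=.
    have [x [y [z [xyz H]]]] := crd_polyhedron p.
    case: x y z xyz H => [x|x] [y|y] [z|z] //= xyz H.
    + by exists z; [rewrite /= mem_enum|exists x, y].
    + by exists y; [rewrite /= mem_enum|exists x, z; split=> //; exact: in_tri_swap23].
    + exists x; first by rewrite /= mem_enum.
      by exists y, z; split=> //; apply/in_tri_swap23/in_tri_swap12.
  apply: bigsetU_compact => f _; have [v0 [v1 [v2 [v3 fq]]]] := quad_ex f.
  exact: (@cface_compact R G F side p0 f v0 v1 v2 v3 fq).
- have L p : exists v, linked p (qpt v).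
    have [x [y [z [xyz H]]]] := crd_polyhedron p.
    have [v [y' [z' [vyz H']]]] : exists v y z, tri (inl v) y z /\ in_tri (crd p) (inl v) y z.
      case: x xyz H => [v|f] xyz H; first by exists v, y, z.
      case: y xyz H => [v|//] xyz H; exists v, (inr f), z; split; first exact: tri12.
      exact: in_tri_swap12.
    have [A [cA Ap Av _]] := cone_connected tri23 trin p0 vyz H'.
    by exists v, A.
  have LL p q : linked p q.
    have [u pu] := L p; have [v qv] := L q.
    by apply: linked_trans pu (linked_trans (linked_vtx u v) (linked_sym qv)).
  pose D q := sval (cid (LL p0 q)).
  have DP q : [/\ connected (D q), D q p0 & D q q] by exact: (svalP (cid (LL p0 q))).
  have -> : [set: space] = \bigcup_(q in setT) D q.
    by apply/seteqP; split=> // q _; exists q => //; have [] := DP q.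
  apply: bigcup_connected => [|q _]; last by have [] := DP q.
  by exists p0 => q _; have [] := DP q.
- move=> p; have [x [y [z [xyz H]]]] := crd_polyhedron p.
  have [a ap] : exists a : X, star a p.
    have [x0 xout xsum] := H.
    have [xp|xp] := ltP 0 (crd p x); first by exists x.
    have [yp|yp] := ltP 0 (crd p y); first by exists y.
    by exists z; rewrite /star /=; lra.
  exists (star a); split=> //; [exact: open_star|exact: disk_star].
Qed.

End QuadSurface.

(** * Moebius bands *)

Section Moebius.
Variables (R : realType) (G : simple_graph) (F : finType).
Variable side : F -> rel (vertex G).
Local Notation V := (vertex G).
Local Notation X := (V + F)%type.
Local Notation tri := (tri side).
Local Notation space := (@space R X tri).
Local Notation polyhedron := (@polyhedron R X tri).

(* The strip crosses each edge inside its middle third, so that the vertices on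
   its boundary may coincide. *)
Definition third (t : R) : R := (1 + t) / 3.

Lemma thirdP (t : R) : 0 <= t <= 1 -> 1 / 3 <= third t <= 2 / 3.
Proof. by rewrite /third => /andP[? ?]; apply/andP; split; lra. Qed.

(** Injectivity is required only for [0 < s < 1], where a positive coordinate at the centre of [f]
    tells the pieces apart. The rungs at the two ends are shared by consecutive pieces and are
    compared separately. *)
Record strip_piece (f : F) (a b c d : V) (h : R * R -> X -> R) : Prop := StripPiece {
  piece_continuous : forall z, continuous (fun q => h q z);
  piece_polyhedron : forall q, closed_square q -> polyhedron (h q);
  piece_start : forall t, 0 <= t <= 1 -> h (0, t) = seg (inl a) (inl b) (third t);
  piece_end : forall t, 0 <= t <= 1 -> h (1, t) = seg (inl c) (inl d) (third t);
  piece_face : forall s t, 0 < s < 1 -> 0 <= t <= 1 -> 0 < h (s, t) (inr f);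
  piece_other_face : forall q g, g != f -> h q (inr g) = 0;
  piece_inj : forall s t s' t', 0 < s < 1 -> 0 <= t <= 1 -> 0 < s' < 1 ->
    0 <= t' <= 1 -> h (s, t) = h (s', t') -> (s, t) = (s', t') }.

Lemma continuous_quad_crd (f : F) (v0 v1 v2 v3 : V) (l1 l2 : R * R -> R) (z : X) :
  continuous l1 -> continuous l2 ->
  continuous (fun q => quad_crd f v0 v1 v2 v3 (l1 q, l2 q) z).
Proof.
move=> cl1 cl2; have [c0 c1 c2 c3 cc] := @continuous_sq R.
have cl : continuous (fun q => (l1 q, l2 q)).
  by move=> q; exact: (cvg_pair (cl1 q) (cl2 q)).
have cM (h : R * R -> R) (b : bool) : continuous h ->
    continuous (fun q => h (l1 q, l2 q) *+ b).
  move=> ch; case: b => //=; last exact: fcont_cst.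
  by move=> q; exact: (continuous_comp (cl q) (ch _)).
by case: z => [v|g] /=; do ?[apply: fcontD]; exact: cM.
Qed.

Lemma strip_piece_opposite f v0 v1 v2 v3 : quad side f v0 v1 v2 v3 ->
  exists h, strip_piece f v0 v3 v1 v2 h.
Proof.
move=> fq; exists (fun q => quad_crd f v0 v1 v2 v3 (q.1, third q.2)).
have os s t : 0 < s < 1 -> 0 <= t <= 1 -> open_square (s, third t).
  move=> s01 /thirdP/andP[? ?]; rewrite /open_square /= !in_itv /=.
  by split=> //; apply/andP; split; lra.
split.
- move=> z; apply: continuous_quad_crd; first exact: fcont_fst.
  apply: fcontM; last exact: fcont_cst.
  by apply: fcontD; [exact: fcont_cst|exact: fcont_snd].
- move=> [s t] [/= s01 t01]; apply: (polyhedron_quad fq).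
  split=> //=; move: t01; rewrite /= !in_itv /= => /thirdP/andP[? ?].
  by apply/andP; split; lra.
- move=> t /thirdP/andP[? ?] /=.
  have [|_ _ _] := @quad_crd_sides R G F f v0 v1 v2 v3 (1 - third t).
    by apply/andP; split; lra.
  by rewrite subKr seg_rev subKr.
- move=> t /thirdP/andP[? ?] /=.
  by have [|_ -> _ _] := @quad_crd_sides R G F f v0 v1 v2 v3 (third t);
    [apply/andP; split; lra|].
- move=> s t s01 t01; have [_ _ _ _ ->] := quad_crdE fq (s, third t).
  exact/sqc_gt0/os.
- by move=> q g gf /=; rewrite (negbTE gf).
- move=> s t s' t' s01 t01 s01' t01' /= /(congr1 (@quad_inv R G F f v1 v2 v3)).
  rewrite !(quad_crdK fq) /third => -[-> E]; congr pair; lra.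
Qed.

(** The strip turns around the corner [v3], placed at [(0, 1)]: for [d = third t] it follows the
    segment from [(0, 1 - d)] to [(d, 1)]. These segments are parallel to a diagonal and never
    shrink to a point, as [d > 0]. *)
Lemma strip_piece_adjacent f v0 v1 v2 v3 : quad side f v0 v1 v2 v3 ->
  exists h, strip_piece f v3 v0 v3 v2 h.
Proof.
move=> fq.
exists (fun q => quad_crd f v0 v1 v2 v3 (q.1 * third q.2, 1 - third q.2 + q.1 * third q.2)).
split.
- have ct : continuous (fun q : R * R => third q.2).
    apply: fcontM; last exact: fcont_cst.
    by apply: fcontD; [exact: fcont_cst|exact: fcont_snd].
  have cm : continuous (fun q : R * R => q.1 * third q.2).
    by apply: fcontM => //; exact: fcont_fst.
  move=> z; apply: continuous_quad_crd => //.
  by apply: fcontD => //; apply: fcontB => //; exact: fcont_cst.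
- move=> [s t] [/= s01 t01]; apply: (polyhedron_quad fq).
  move: s01 t01; rewrite /= !in_itv /= => /andP[s0 s1] /thirdP/andP[t0 t1].
  by split=> /=; rewrite in_itv /=; apply/andP; split; nra.
- move=> t /thirdP/andP[? ?] /=.
  have [|_ _ _] := @quad_crd_sides R G F f v0 v1 v2 v3 (third t).
    by apply/andP; split; lra.
  by rewrite mul0r addr0.
- move=> t /thirdP/andP[? ?] /=.
  have [|_ _ + _] := @quad_crd_sides R G F f v0 v1 v2 v3 (1 - third t).
    by apply/andP; split; lra.
  by rewrite mul1r subrK subKr => ->; rewrite seg_rev subKr.
- move=> s t /andP[s0 s1] /thirdP/andP[t0 t1].
  have [_ _ _ _ ->] := quad_crdE fq (s * third t, 1 - third t + s * third t).
  apply: sqc_gt0.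
  by split=> /=; rewrite in_itv /=; apply/andP; split; nra.
- by move=> q g gf /=; rewrite (negbTE gf).
- move=> s t s' t' s01 /thirdP t01 s01' /thirdP t01' /= /(congr1 (@quad_inv R G F f v1 v2 v3)).
  rewrite !(quad_crdK fq) => -[E1 E2].
  have E : third t = third t' by lra.
  rewrite -E in E1; have t0 : third t != 0 by apply/eqP => t0; move: t01; rewrite t0; lra.
  have -> := mulIf t0 E1; congr pair; move: E; rewrite /third; lra.
Qed.

Variable p0 : space.
Variables (k : nat) (fc : nat -> F) (ra rb : nat -> V).
Hypothesis k_gt0 : (0 < k)%N.
Hypothesis fc_inj : forall i j, (i < k)%N -> (j < k)%N -> fc i = fc j -> i = j.
Hypothesis rung_neq : forall i, (i < k)%N -> ra i != rb i.
Hypothesis rung_inj : forall i j, (i < k)%N -> (j < k)%N ->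
  ra i = ra j /\ rb i = rb j \/ ra i = rb j /\ rb i = ra j -> i = j.
Hypothesis twist : ra k = rb 0%N /\ rb k = ra 0%N.
Hypothesis pieces : forall i, (i < k)%N ->
  exists h, strip_piece (fc i) (ra i) (rb i) (ra i.+1) (rb i.+1) h.

(* The pieces are glued by a telescoping sum: the [j]-th summand moves from the
   [j]-th rung to the next one while [k * s] runs from [j] to [j + 1]. *)
Lemma moebius_strip : nonorientable R space.
Proof.
have /boolp.choice[h hP] : forall i, exists hi : R * R -> X -> R, (i < k)%N ->
    strip_piece (fc i) (ra i) (rb i) (ra i.+1) (rb i.+1) hi.
  move=> i; have [ik|ik] := ltnP i k; last by exists (fun _ _ => 0).
  by have [hi hiP] := pieces ik; exists hi.
pose rung i t : X -> R := seg (inl (ra i)) (inl (rb i)) (third t).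
pose clamp (x : R) : R := Num.max 0 (Num.min 1 x).
pose H (q : R * R) : X -> R := fun z => rung 0%N q.2 z
  + \sum_(0 <= j < k) (h j (clamp (k%:R * q.1 - j%:R), q.2) z - h j (0, q.2) z).
have k0 : 0 < k%:R :> R by rewrite ltr0n.
have clamp0 (x : R) : x <= 0 -> clamp x = 0.
  move=> x0; rewrite /clamp; apply/max_idPl.
  by rewrite ge_min x0 orbT.
have clamp1 (x : R) : 1 <= x -> clamp x = 1.
  by move=> x1; rewrite /clamp min_l// max_r.
have clampr (x : R) : 0 <= x <= 1 -> clamp x = x.
  by move=> /andP[x0 x1]; rewrite /clamp min_r// max_r.
(* Pieces before [i] have reached their ends and telescope to the difference of rungs [i] and 0;
   pieces after [i] have not started and contribute 0. *)
have Heval (i : nat) (r t : R) : (i < k)%N -> 0 <= r <= 1 -> 0 <= t <= 1 ->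
    H ((i%:R + r) / k%:R, t) = h i (r, t).
  move=> ik r01 t01; apply/funext => z; rewrite /H /= mulrC divfK ?gt_eqF//.
  have /andP[r0 r1] := r01.
  rewrite (@big_cat_nat _ _ _ i)//=; last exact: ltnW.
  rewrite [X in _ + (_ + X)]big_ltn//.
  have -> : clamp (i%:R + r - i%:R) = r by rewrite addrAC subrr add0r clampr.
  have -> : \sum_(i.+1 <= j < k) (h j (clamp (i%:R + r - j%:R), t) z - h j (0, t) z) = 0.
    rewrite big_nat big1// => j /andP[ij jk]; rewrite clamp0 ?subrr//.
    have : i%:R + 1 <= j%:R :> R by rewrite natr1 ler_nat.
    by move: r1; lra.
  have -> : \sum_(0 <= j < i) (h j (clamp (i%:R + r - j%:R), t) z - h j (0, t) z) =
      \sum_(0 <= j < i) (rung j.+1 t z - rung j t z).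
    apply: eq_big_nat => j /andP[_ ji]; have jk := ltn_trans ji ik.
    have : j%:R + 1 <= i%:R :> R by rewrite natr1 ler_nat.
    move=> ?; rewrite clamp1; last lra.
    by rewrite (piece_end (hP _ jk))// (piece_start (hP _ jk)).
  rewrite telescope_sumr// (piece_start (hP _ ik))// -/(rung i t); ring.
have Hfloor (s : R) : 0 <= s < 1 -> exists (i : nat) (r : R), [/\ (i < k)%N, 0 <= r < 1 & s = (i%:R + r) / k%:R].
  move=> /andP[s0 s1].
  have [i [ik i1 i2]] : exists i, [/\ (i < k)%N, i%:R <= k%:R * s & k%:R * s < i%:R + 1].
    have : k%:R * s < k%:R by rewrite -[X in _ < X]mulr1 ltr_pM2l.
    have : 0 <= k%:R * s by rewrite mulr_ge0// ltW.
    move: (k%:R * s) => x x0; elim: (k) => [|m IH] xk; first by exfalso; move: x0 xk; lra.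
    have [xm|xm] := ltP x m%:R; last first.
      by exists m; split=> //; rewrite natr1.
    by have [i [im ? ?]] := IH xm; exists i; split=> //; exact: ltnW.
  exists i, (k%:R * s - i%:R); split=> //; first by apply/andP; split; lra.
  by rewrite addrC subrK mulrC mulKf ?gt_eqF.
have Hend (t : R) : 0 <= t <= 1 -> H (1, t) = H (0, 1 - t).
  move=> t01; have /andP[t0 t1] := t01.
  have t01' : 0 <= 1 - t <= 1 by apply/andP; split; lra.
  have kk : (k.-1 < k)%N by rewrite ltn_predL.
  have E1 : 1 = (k.-1%:R + 1) / k%:R :> R by rewrite natr1 prednK// divff ?gt_eqF.
  have E0 : 0 = (0%:R + 0) / k%:R :> R by rewrite addr0 mul0r.
  have -> : H (1, t) = h k.-1 (1, t) by rewrite {1}E1 Heval// ler01 lexx.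
  have -> : H (0, 1 - t) = h 0%N (0, 1 - t) by rewrite {1}E0 Heval// lexx ler01.
  rewrite (piece_end (hP _ kk))// prednK// (piece_start (hP _ k_gt0))//.
  have [-> ->] := twist; rewrite seg_rev; congr seg.
  by rewrite /third; field.
have Hpoly q : closed_square q -> polyhedron (H q).
  case: q => s t [/=]; rewrite !in_itv /= => /andP[s0 s1] t01.
  have main (s' t' : R) : 0 <= s' < 1 -> 0 <= t' <= 1 -> polyhedron (H (s', t')).
    move=> s'01 t'01; have [i [r [ik /andP[r0 r1] ->]]] := Hfloor _ s'01.
    have r01 : 0 <= r <= 1 by rewrite r0 ltW.
    rewrite Heval//; apply: (piece_polyhedron (hP _ ik)).
    by split=> /=; rewrite in_itv.
  have [s1'|s1'] := ltP s 1; first by apply: main; rewrite ?s0.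
  have -> : s = 1 by apply/eqP; rewrite eq_le s1.
  by rewrite Hend//; apply: main; rewrite ?lexx ?ltr01//; move/andP: t01 => [? ?]; apply/andP; split; lra.
have rung_face (i : nat) (t : R) (g : F) : rung i t (inr g) = 0 by rewrite /rung seg_out.
have Hinj (s t s' t' : R) : 0 <= s < 1 -> 0 <= t <= 1 -> 0 <= s' < 1 -> 0 <= t' <= 1 ->
    H (s, t) = H (s', t') -> (s, t) = (s', t').
  move=> s01 t01 s01' t01'.
  have [i [r [ik /andP[r0 r1] ->]]] := Hfloor _ s01.
  have [i' [r' [ik' /andP[r0' r1'] ->]]] := Hfloor _ s01'.
  have r01 : 0 <= r <= 1 by rewrite r0 ltW.
  have r01' : 0 <= r' <= 1 by rewrite r0' ltW.
  rewrite !Heval// => E.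
  (* [r = 0] means a point on a rung. Two rung points are compared through their end vertices, whose
     coordinates are positive because of the middle third; a rung point and an interior point differ
     at a centre. *)
  have [rz|rz] := eqVneq r 0; have [rz'|rz'] := eqVneq r' 0.
  - move: E; rewrite rz rz' (piece_start (hP _ ik))// (piece_start (hP _ ik'))// => E.
    have nE j : (j < k)%N -> (inl (ra j) : X) != inl (rb j).
      by move=> jk; rewrite (inj_eq inl_inj) rung_neq.
    have /andP[q0 q1] := thirdP t01.
    have Ea := congr1 (fun c => c (inl (ra i))) E; have Eb := congr1 (fun c => c (inl (rb i))) E.
    move: Ea Eb; rewrite /= seg_l ?nE// seg_r ?nE// /seg !(inj_eq inl_inj) => Ea Eb.
    have ha : (ra i == ra i') || (ra i == rb i').
      apply: contraT; rewrite negb_or => /andP[/negbTE n1 /negbTE n2].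
      move: Ea; rewrite n1 n2 !mulr0n addr0 => Ea; exfalso; move: Ea q1; lra.
    have hb : (rb i == ra i') || (rb i == rb i').
      apply: contraT; rewrite negb_or => /andP[/negbTE n1 /negbTE n2].
      move: Eb; rewrite n1 n2 !mulr0n addr0 => Eb; exfalso; move: Eb q0; lra.
    have ii : i = i'.
      apply: rung_inj => //.
      case/orP: ha => /eqP ha; case/orP: hb => /eqP hb; [|by left|by right|];
        by have := rung_neq ik; rewrite ha hb eqxx.
    subst i'; congr pair; move: Eb; rewrite eqxx eq_sym (negbTE (rung_neq ik)) mulr0n add0r mulr1n.
    by rewrite /third; lra.
  - have := piece_face (hP _ ik') (_ : 0 < r' < 1) t01'.
    rewrite -E rz (piece_start (hP _ ik))// seg_out// ltxx => h0.
    by have := h0 _; rewrite r1' lt_def rz' r0'; move=> /(_ isT).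
  - have := piece_face (hP _ ik) (_ : 0 < r < 1) t01.
    rewrite E rz' (piece_start (hP _ ik'))// seg_out// ltxx => h0.
    by have := h0 _; rewrite r1 lt_def rz r0; move=> /(_ isT).
  - have rr : 0 < r < 1 by rewrite lt_def rz r0.
    have rr' : 0 < r' < 1 by rewrite lt_def rz' r0'.
    have ii : i = i'.
      apply: fc_inj => //; apply/eqP; apply: contraT => ff.
      have := piece_face (hP _ ik) rr t01.
      by rewrite E (piece_other_face (hP _ ik')) ?ltxx.
    by subst i'; have [-> ->] := piece_inj (hP _ ik) rr t01 rr' t01' E.
exists (fun q => mk p0 (H q)); split.
  apply: within_mk => [z|]; last exact: Hpoly.
  apply: continuous_subspaceT.
  have c3 : continuous (fun q : R * R => third q.2).
    apply: fcontM; last exact: fcont_cst.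
    by apply: fcontD; [exact: fcont_cst|exact: fcont_snd].
  have cM (g : R * R -> R) (b : bool) : continuous g -> continuous (fun q => g q *+ b).
    by case: b => //= _; exact: fcont_cst.
  apply: fcontD.
    by apply: fcontD; apply: cM => //; apply: fcontB => //; exact: fcont_cst.
  rewrite (_ : (fun q => _) = fun q : R * R => \sum_(j < k)
      (h j (clamp (k%:R * q.1 - j%:R), q.2) z - h j (0, q.2) z)); last first.
    by apply/funext => q; rewrite big_mkord.
  apply: fcont_sum => j; have jk := ltn_ord j.
  have cc : continuous (fun q : R * R => (clamp (k%:R * q.1 - j%:R), q.2)).
    have c1 : continuous (fun q : R * R => clamp (k%:R * q.1 - j%:R)).
      apply: fcont_max; first exact: fcont_cst.
      apply: fcont_min; first exact: fcont_cst.
      apply: fcontB; last exact: fcont_cst.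
      by apply: fcontM; [exact: fcont_cst|exact: fcont_fst].
    by move=> q; exact: (cvg_pair (c1 q) (@fcont_snd R q)).
  have c0 : continuous (fun q : R * R => ((0 : R), q.2)).
    have cz : continuous (fun _ : R * R => 0 : R) by exact: fcont_cst.
    by move=> q; exact: (cvg_pair (cz q) (@fcont_snd R q)).
  have ch : continuous (fun q => h j q z) by have [ch _ _ _ _ _ _] := hP _ jk; exact: ch.
  apply: fcontB => q.
    exact: (continuous_comp (cc q) (ch _)).
  exact: (continuous_comp (c0 q) (ch _)).
move=> [s t] [s' t'] sq sq'.
have Hcrd q : closed_square q -> crd (mk p0 (H q)) = H q by move=> /Hpoly; exact: mkK.
have [s01 t01] : 0 <= s <= 1 /\ 0 <= t <= 1 by move: sq => [/=]; rewrite !in_itv.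
have [s01' t01'] : 0 <= s' <= 1 /\ 0 <= t' <= 1 by move: sq' => [/=]; rewrite !in_itv.
have rev01 (x : R) : 0 <= x <= 1 -> 0 <= 1 - x <= 1.
  by move=> /andP[? ?]; apply/andP; split; lra.
have z01 : 0 <= (0 : R) < 1 by rewrite lexx ltr01.
have lt1 (x : R) : 0 <= x <= 1 -> x != 1 -> 0 <= x < 1.
  by move=> /andP[x0 x1] xn; rewrite x0 lt_neqAle xn.
split.
  move=> /(congr1 (@crd R X tri)); rewrite !Hcrd//.
  have [->|s1] := eqVneq s 1; have [->|s1'] := eqVneq s' 1.
  - rewrite !Hend// => /(Hinj _ _ _ _ z01 (rev01 _ t01) z01 (rev01 _ t01'))[E].
    by apply: Or31; congr pair; move: E; lra.
  - rewrite Hend// => /(Hinj _ _ _ _ z01 (rev01 _ t01) (lt1 _ s01' s1') t01')[E1 E2].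
    by apply: Or33; split=> //=; rewrite -E2 subKr.
  - rewrite [in RHS]Hend// => /(Hinj _ _ _ _ (lt1 _ s01 s1) t01 z01 (rev01 _ t01'))[E1 E2].
    by apply: Or32; split=> //=; rewrite E2 subKr.
  - move=> /(Hinj _ _ _ _ (lt1 _ s01 s1) t01 (lt1 _ s01' s1') t01') ->.
    exact: Or31.
case=> [[-> ->]//|[/= -> -> ->]|[/= -> -> ->]]; congr mk.
- by rewrite Hend ?rev01// subKr.
- by rewrite Hend ?rev01// subKr.
Qed.

End Moebius.

Lemma strip_piece_rev (R : realType) (G : simple_graph) (F : finType)
    (side : F -> rel (vertex G)) f a b c d h :
  @strip_piece R G F side f a b c d h -> 
  exists h' : R * R -> vertex G + F -> R, strip_piece side f b a d c h'.
Proof.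
move=> [h1 h2 h3 h4 h5 h6 h7]; exists (fun q => h (q.1, 1 - q.2)).
have rev01 (x : R) : 0 <= x <= 1 -> 0 <= 1 - x <= 1.
  by move=> /andP[? ?]; apply/andP; split; lra.
have thirdE (t : R) : third (1 - t) = 1 - third t by rewrite /third; field.
split.
- move=> z.
  have cl : continuous (fun q : R * R => (q.1, 1 - q.2)).
    have c2 : continuous (fun q : R * R => 1 - q.2).
      by apply: fcontB; [exact: fcont_cst|exact: fcont_snd].
    by move=> q; exact: (cvg_pair (@fcont_fst R q) (c2 q)).
  by move=> q; exact: (continuous_comp (cl q) (h1 z _)).
- move=> [s t] [/= s01 t01]; apply: h2; split=> //=.
  by move: t01; rewrite !in_itv; exact: rev01.
- by move=> t t01 /=; rewrite h3 ?rev01// thirdE -seg_rev.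
- by move=> t t01 /=; rewrite h4 ?rev01// thirdE -seg_rev.
- by move=> s t s01 t01; apply: h5 => //; exact: rev01.
- by move=> q g; exact: h6.
- move=> s t s' t' s01 t01 s01' t01' /= E.
  by have [-> E2] := h7 _ _ _ _ s01 (rev01 _ t01) s01' (rev01 _ t01') E; congr pair; lra.
Qed.

Lemma quad_rot (G : simple_graph) (F : finType) (side : F -> rel (vertex G)) f v0 v1 v2 v3 :
  quad side f v0 v1 v2 v3 -> quad side f v1 v2 v3 v0.
Proof.
move=> [u s]; split; first by rewrite -(rot_uniq 3) /rot /=.
by move=> a b; rewrite s !inE; do 8!case: (_ == _).
Qed.

Local Close Scope classical_set_scope.
Local Open Scope set_scope.

(** * The quadrangulation of the nearly complete bipartite graph *)

Section Construction.
Variable n : nat.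
Hypothesis n_ge3 : (3 <= n)%N.
Local Notation G := (nearly_complete_bipartite (2 * n + 1)%N (2 * n)%N (2 * n)%N).
Local Notation W := 'I_(2 * n + 1).
Local Notation B := 'I_(2 * n).

(** With unordered pairs of white and of black vertices, the different readings of [opposite] from
    the corners of a quadrilateral give the same face. *)
Definition is_face (q : {set W} * {set B}) : bool := `[< exists (x x' : W) (y y' : B),
  opposite n x y x' y' /\ q = ([set x; x'], [set y; y']) >].
Definition face_type : finType := {q : {set W} * {set B} | is_face q}.

Definition fside (f : face_type) : rel (vertex G) := fun u v =>
  match u, v with
  | inl x, inr y | inr y, inl x => (x \in (val f).1) && (y \in (val f).2)
  | _, _ => false
  end.

Lemma fside_sym f : symmetric (fside f).
Proof. by move=> [x|y] [x'|y']. Qed.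

Lemma faceE (f : face_type) : exists (x x' : W) (y y' : B),
  opposite n x y x' y' /\ val f = ([set x; x'], [set y; y']).
Proof. by case: f => q /= /asboolP. Qed.

Lemma face_at f (x : W) (y : B) : fside f (inl x) (inr y) -> exists (x' : W) (y' : B),
  opposite n x y x' y' /\ val f = ([set x; x'], [set y; y']).
Proof.
have [a [a' [b [b' [opp fE]]]]] := faceE f; rewrite /= fE /= !inE.
have oppl := opposite_swapl n_ge3 opp; have oppr := opposite_swapr n_ge3 opp.
have opps := opposite_swap n_ge3 opp.
move=> /andP[/orP[]/eqP -> /orP[]/eqP ->].
- by exists a', b'.
- by exists a', b; split=> //; rewrite [[set b; b']]finset.setUC.
- by exists a, b'; split=> //; rewrite [[set a; a']]finset.setUC.
- by exists a, b; split=> //; rewrite [[set b; b']]finset.setUC [[set a; a']]finset.setUC.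
Qed.

Lemma mk_face (x : W) (y : B) a b : opposite n x y a b ->
  exists (x' : W) (y' : B) (f : face_type),
    [/\ x' = a :> nat, y' = b :> nat & val f = ([set x; x'], [set y; y'])].
Proof.
move=> o; have [aN bN _ _ _] := opposite_edge n_ge3 (opposite_swap n_ge3 o).
have aN' : (a < 2 * n + 1)%N by rewrite addn1.
have H : is_face ([set x; Ordinal aN'], [set y; Ordinal bN]).
  by apply/asboolP; exists x, (Ordinal aN'), y, (Ordinal bN).
by exists (Ordinal aN'), (Ordinal bN), (exist (fun q => is_true (is_face q)) _ H).
Qed.

Lemma fside_adj f u v : fside f u v -> adj u v.
Proof.
have main x y : fside f (inl x) (inr y) -> @adj G (inl x) (inr y).
  move=> /face_at[x' [y' [/(opposite_edge n_ge3)[_ _ xy _ _] _]]] /=.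
  by apply/negP => /andP[/eqP].
case: u v => [x|y] [x'|y'] //; first exact: main.
by rewrite fside_sym adj_sym; exact: main.
Qed.

Lemma quad_of f (x x' : W) (y y' : B) : val f = ([set x; x'], [set y; y']) ->
  x != x' -> y != y' -> quad fside f (inl x) (inr y) (inl x') (inr y').
Proof.
move=> fE xx yy; split.
  by rewrite /= !inE /= ?(inj_eq inl_inj) ?(inj_eq inr_inj) (negbTE xx) (negbTE yy).
move=> [a|b] [a'|b']; rewrite /= ?fE /= !inE !xpair_eqE /= ?(inj_eq inl_inj) ?(inj_eq inr_inj) ?andbF ?orbF //=.
  by case: (a == x); case: (a == x'); case: (b' == y); case: (b' == y').
by case: (a' == x); case: (a' == x'); case: (b == y); case: (b == y').
Qed.

Lemma fquad f : exists v0 v1 v2 v3, quad fside f v0 v1 v2 v3.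
Proof.
have [x [x' [y [y' [/(opposite_edge n_ge3)[_ _ _ xx yy] fE]]]]] := faceE f.
exists (inl x), (inr y), (inl x'), (inr y'); apply: quad_of => //.
  by apply/eqP => xE; apply: xx; rewrite xE.
by apply/eqP => yE; apply: yy; rewrite yE.
Qed.

Lemma fedge_two u v : @adj G u v ->
  exists f g, f != g /\ forall h, fside h u v = (h == f) || (h == g).
Proof.
have main (x : W) (y : B) : @adj G (inl x) (inr y) -> exists f g, f != g /\
    forall h, fside h (inl x) (inr y) = (h == f) || (h == g).
  move=> /= xy; have xn : (x <= 2 * n)%N by have := ltn_ord x; lia.
  have {}xy : (x : nat) <> y.
    by move=> xE; move: xy; rewrite xE eqxx ltn_ord.
  have [[a b] [[c d] [ne oE]]] := two_oppositesP n_ge3 xn (ltn_ord y) xy.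
  have o1 : opposite n x y a b by apply/oE; left.
  have o2 : opposite n x y c d by apply/oE; right.
  have [x1 [y1 [f [x1E y1E fE]]]] := mk_face o1.
  have [x2 [y2 [g [x2E y2E gE]]]] := mk_face o2.
  have [_ _ _ ax yb] := opposite_edge n_ge3 o1.
  exists f, g; split.
    apply/eqP => fg; apply: ne; move: gE; rewrite -fg fE => -[Ex Ey].
    have : x1 \in [set x; x2] by rewrite -Ex !inE eqxx orbT.
    have : y1 \in [set y; y2] by rewrite -Ey !inE eqxx orbT.
    rewrite !inE => /orP[/eqP yE|/eqP yE]; first by case: yb; rewrite -y1E yE.
    case/orP => /eqP xE; first by case: ax; rewrite -x1E xE.
    by rewrite -x1E -y1E -x2E -y2E xE yE.
  move=> h; apply/idP/orP => [/face_at[x' [y' [/oE H hE]]]|].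
    case: H => -[x'E y'E]; [left|right]; apply/eqP/val_inj; rewrite hE ?fE ?gE.
      by congr ([set _; _], [set _; _]); apply/val_inj; rewrite /= ?x1E ?y1E.
    by congr ([set _; _], [set _; _]); apply/val_inj; rewrite /= ?x2E ?y2E.
  by case=> /eqP ->; rewrite /= ?fE ?gE /= !inE !eqxx.
case: u v => [x|y] [x'|y'] //; first exact: main.
rewrite adj_sym => /main[f [g [fg H]]]; by exists f, g.
Qed.

Lemma fcorner_connect v f g u w :
  fside f v u -> fside g v w -> connect (corner_adj fside v) f g.
Proof.
have share h k z : fside h v z -> fside k v z -> connect (corner_adj fside v) h k.
  by move=> hz kz; apply: connect1; apply/existsP; exists z; rewrite hz kz.
case: v share u w => [x|y] share [u|u] [w|w] // fu gw.
(* [P b] says that every face on the edge from [x] to [b] can be reached from [f]. It passes from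
   [b] to [b'] because the face with these two corners contains both edges. *)
- pose P b := forall (z : B) h, z = b :> nat -> fside h (inl x) (inr z) ->
    connect (corner_adj fside (inl x)) f h.
  have xn : (x <= 2 * n)%N by have := ltn_ord x; lia.
  have edge k z : fside k (inl x) (inr z) -> (x : nat) <> z.
    by move=> /face_at[x' [y' [/(opposite_edge n_ge3)[]]]].
  have clos : forall b b' x', opposite n x b x' b' -> P b -> P b'.
    move=> b b' x' o Pb z h zb' hz.
    have [_ bN _ _ _] := opposite_edge n_ge3 o.
    have [x1 [y1 [k [_ y1E kE]]]] := @mk_face x (Ordinal bN) _ _ o.
    have zE : z = y1 by apply/val_inj; rewrite /= zb' y1E.
    apply: (connect_trans (Pb (Ordinal bN) k erefl _)).
      by rewrite /= kE /= !inE !eqxx.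
    by apply: (share _ _ (inr z)) => //; rewrite /= kE /= zE !inE !eqxx orbT.
  have Pu : P u.
    by move=> z h zu hz; apply: (share _ _ (inr u)) => //; rewrite -(val_inj zu).
  have Pw : P w.
    exact: (@white_connect n n_ge3 P x xn clos u w (ltn_ord u) (ltn_ord w) (edge _ _ fu) (edge _ _ gw) Pu).
  exact: (Pw w g erefl gw).
- pose P a := forall (z : W) h, z = a :> nat -> fside h (inr y) (inl z) ->
    connect (corner_adj fside (inr y)) f h.
  have le (z : W) : (z <= 2 * n)%N by have := ltn_ord z; lia.
  have edge k z : fside k (inr y) (inl z) -> (z : nat) <> y.
    by rewrite fside_sym => /face_at[x' [y' [/(opposite_edge n_ge3)[]]]].
  have clos : forall a a' y', opposite n a y a' y' -> P a -> P a'.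
    move=> a a' y' o Pa z h za' hz.
    have [aN _ _ _ _] := opposite_edge n_ge3 o.
    have aN' : (a < 2 * n + 1)%N by rewrite addn1.
    have [x1 [y1 [k [x1E _ kE]]]] := @mk_face (Ordinal aN') y _ _ o.
    have zE : z = x1 by apply/val_inj; rewrite /= za' x1E.
    apply: (connect_trans (Pa (Ordinal aN') k erefl _)).
      by rewrite /= kE /= !inE !eqxx.
    by apply: (share _ _ (inl z)) => //; rewrite /= kE /= zE !inE !eqxx orbT.
  have Pu : P u.
    by move=> z h zu hz; apply: (share _ _ (inl u)) => //; rewrite -(val_inj zu).
  have Pw : P w.
    exact: (@black_connect n n_ge3 P y (ltn_ord y) clos u w (le u) (le w) (edge _ _ fu) (edge _ _ gw) Pu).
  exact: (Pw w g erefl gw).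
Qed.

Lemma fvertex_adj v : exists u, @adj G v u.
Proof.
case: v => [x|y].
  have [b0 b1] : (0 < 2 * n)%N /\ (1 < 2 * n)%N by lia.
  have [x0|x0] := eqVneq (x : nat) 0%N.
    by exists (inr (Ordinal b1)); rewrite /= x0.
  by exists (inr (Ordinal b0)); rewrite /= (negbTE x0).
have wN : (2 * n < 2 * n + 1)%N by lia.
by exists (inl (Ordinal wN)); rewrite /= ltnn andbF.
Qed.

Lemma fgraph_connect u v : connect (@adj G) u v.
Proof.
have wN : (2 * n < 2 * n + 1)%N by lia.
(* The white vertex [2 * n] is adjacent to every black vertex. *)
pose o : vertex G := inl (Ordinal wN).
have csym := sym_connect_sym (@adj_sym G).
have ob y : connect (@adj G) o (inr y) by apply: connect1; rewrite /= ltnn andbF.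
have oa w : connect (@adj G) o w.
  case: w => [x|y //]; have [[x'|y] xy] := fvertex_adj (inl x); first by [].
  by apply: connect_trans (ob y) _; apply: connect1; rewrite adj_sym.
by apply: connect_trans (oa v); rewrite csym.
Qed.

Lemma opposite_added x y x' y' : added n x y x' y' -> opposite n x y x' y'.
Proof. by move=> ?; do 3!right. Qed.

(** The strip goes straight across the square {1, 2} x {3, 4}, which exchanges the colours of the
    left and right ends of its rungs. It then turns around white 2, black 5 and white 1 inside {2,
    2n} x {4, 5}, {1, 2} x {5, [sigma n 5]} and {1, 4} x {3, 5}, and each turn keeps the colours.
    One straight crossing thus brings it back to its first rung, the edge from white 1 to black 3,
    reversed. *)
Lemma fnonorientable (R : realType) (p0 : space R (tri fside)) : nonorientable R (space R (tri fside)).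
Proof.
have W1 : (1 < 2 * n + 1)%N by lia.
have W2 : (2 < 2 * n + 1)%N by lia.
have B3 : (3 < 2 * n)%N by lia.
have B4 : (4 < 2 * n)%N by lia.
have B5 : (5 < 2 * n)%N by lia.
pose w1 : W := Ordinal W1; pose w2 : W := Ordinal W2.
pose b3 : B := Ordinal B3; pose b4 : B := Ordinal B4; pose b5 : B := Ordinal B5.
have s1 := sigma1 n_ge3; have s3 := sigma3 n_ge3; have s2 := sigma2 n.
have s5 := sigmaP n_ge3 B5.
have oA : opposite n w1 b3 2 4.
  by right; left; split; rewrite /= ?s1 ?s3; lia.
have oB : opposite n w2 b4 (2 * n) 5 by apply: opposite_added; rewrite /added /pairs2 /=; lia.
have oC : opposite n w2 b5 1 (sigma n 5).
  by right; left; split; rewrite /= ?s2; lia.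
have oD : opposite n w1 b5 4 3 by apply: opposite_added; rewrite /added /pairs2 /=; lia.
have [xA [yA [fA [xAE yAE fAE]]]] := mk_face oA.
have [xB [yB [fB [xBE yBE fBE]]]] := mk_face oB.
have [xC [yC [fC [xCE yCE fCE]]]] := mk_face oC.
have [xD [yD [fD [xDE yDE fDE]]]] := mk_face oD.
have ? : xA = w2 by apply/val_inj.
have ? : yA = b4 by apply/val_inj.
have ? : yB = b5 by apply/val_inj.
have ? : xC = w1 by apply/val_inj.
have ? : yD = b3 by apply/val_inj.
subst xA yA yB xC yD.
have y3 : b3 != yC by rewrite -val_eqE /= yCE; apply/eqP; lia.
have y4 : b4 != yC by rewrite -val_eqE /= yCE; apply/eqP; lia.
have y5 : yC != b5 by rewrite -val_eqE /= yCE; apply/eqP; lia.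
pose ra := nth (inl w1 : vertex G) [:: inl w1; inr b4; inr b5; inr b5; inr b3].
pose rb := nth (inl w1 : vertex G) [:: inr b3; inl w2; inl w2; inl w1; inl w1].
pose fc := nth fA [:: fA; fB; fC; fD].
apply: (@moebius_strip R G face_type fside p0 4 fc ra rb) => //.
(* The four faces differ in which of the black vertices 3 and 4 they contain. *)
- pose code (f : face_type) := (b3 \in (val f).2, b4 \in (val f).2).
  have cA : code fA = (true, true) by rewrite /code fAE /= !inE !eqxx ?orbT.
  have cB : code fB = (false, true) by rewrite /code fBE /= !inE.
  have cC : code fC = (false, false) by rewrite /code fCE /= !inE (negbTE y3) (negbTE y4).
  have cD : code fD = (true, false) by rewrite /code fDE /= !inE.
  by move=> [|[|[|[|i]]]] [|[|[|[|j]]]] //= _ _ /(congr1 code); rewrite ?cA ?cB ?cC ?cD.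
- by move=> [|[|[|[|i]]]].
- pose code (v : vertex G) : nat :=
    match v with inl x => (x : nat).*2 | inr y => (y : nat).*2.+1 end.
  by move=> [|[|[|[|i]]]] [|[|[|[|j]]]] //= _ _ [] [/(congr1 code) h1 /(congr1 code) h2];
    move: h1 h2.
- move=> [|[|[|[|i]]]] //= _.
  + have q : quad fside fA (inl w1) (inr b4) (inl w2) (inr b3).
      by apply: quad_of => //; rewrite fAE [[set b4; b3]]finset.setUC.
    exact: (@strip_piece_opposite R G face_type fside _ _ _ _ _ q).
  + have q : quad fside fB (inr b4) (inl xB) (inr b5) (inl w2).
      apply/quad_rot/quad_of => //.
      by rewrite -val_eqE /= xBE; apply/eqP; lia.
    have [h hP] := @strip_piece_adjacent R G face_type fside _ _ _ _ _ q.
    exact: strip_piece_rev hP.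
  + have q : quad fside fC (inl w2) (inr yC) (inl w1) (inr b5).
      by apply: quad_of => //; rewrite fCE [[set yC; b5]]finset.setUC.
    exact: (@strip_piece_adjacent R G face_type fside _ _ _ _ _ q).
  + have q : quad fside fD (inr b5) (inl xD) (inr b3) (inl w1).
      apply/quad_rot/quad_of => //.
      by rewrite -val_eqE /= xDE.
    have [h hP] := @strip_piece_adjacent R G face_type fside _ _ _ _ _ q.
    exact: strip_piece_rev hP.
Qed.

Lemma exists_point (R : realType) : exists p0 : space R (tri fside), True.
Proof.
have W1 : (1 < 2 * n + 1)%N by lia.
have B5 : (5 < 2 * n)%N by lia.
have oD : opposite n (Ordinal W1) (Ordinal B5) 4 3.
  by apply: opposite_added; rewrite /added /pairs2 /=; lia.
have [x [y [f [_ _ fE]]]] := mk_face oD.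
have ft : tri fside (inl (inl (Ordinal W1))) (inl (inr (Ordinal B5))) (inr f).
  by rewrite /= fE /= !inE !eqxx.
have H := polyhedron_seg (tri_swap12 fside_sym) (tri_swap23 fside_sym)
  (tri_neq12 fside_adj) ft (_ : 0 <= (0 : R) <= 1).
have pK := H (introT andP (conj (lexx 0) ler01)).
by exists (exist (fun x => x \in polyhedron (tri fside)) _ (mem_set pK)).
Qed.

End Construction.

Theorem theorem1 (R : realType) (n : nat) (hn : (3 <= n)%N) :
  has_nonorientable_quadrangular_embedding R
    (nearly_complete_bipartite (2 * n + 1)%N (2 * n)%N (2 * n)%N).
Proof.
have [p0 _] := exists_point hn R.
pose colour (v : vertex (nearly_complete_bipartite (2 * n + 1) (2 * n) (2 * n))) :=
  if v is inl _ then true else false.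
have adj_colour u v : adj u v -> colour u != colour v by case: u v => [?|?] [?|?].
exists (space R (tri (@fside n))).
exists (quad_embedding (@fside_sym n) (fside_adj hn) (fedge_two hn) (fvertex_adj hn) p0).
split.
- exact: (space_closed_surface (@fside_sym n) (fside_adj hn) (fquad hn) adj_colour
    (fedge_two hn) (fcorner_connect hn) (fgraph_connect hn) (fvertex_adj hn) p0).
- by apply: fnonorientable.
- exact: (quad_embedding_quadrangular _ _ (fquad hn) adj_colour _ (fcorner_connect hn)).
Qed.
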